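(* Let $(B_t)_{t\in\mathbb{T}_n}$ be an exchange matrix pattern in which some (equivalently every) $B_t$ is mutation equivalent to an acyclic sign-skew-symmetric matrix. Then for every initial vertex $t_0\in\mathbb{T}_n$: (1) for each $t\in\mathbb{T}_n$ and $k\in\{1,\dots,n\}$, $\varepsilon_k(C^{t_0}_t)=\varepsilon_k(\tilde C^{t_0}_t)$; (2) for any $t\in\mathbb{T}_n$ and $i,j$, the $i$-th column of $C^{t_0}_t$ is $\pm e_j$ if and only if the $i$-th column of $\tilde C^{t_0}_t$ is $\pm e_j$; (3) for any $t\in\mathbb{T}_n$, $(G^{t_0}_t)^T\tilde C^{t_0}_t=I_n$; (4) for any $t_1,t\in\mathbb{T}_n$ such that $t_0\overset{k}{\text{---}}t_1$ is an edge, every row of $G^{t_0}_t$ is sign-coherent and \[C^{t_1}_t=\bigl(J_k+[-\varepsilon_k(G^{t_0}_t)B_{t_0}]_+^{k\cdot}\bigr)C^{t_0}_t,\qquad G^{t_1}_t=\bigl(J_k+[\varepsilon_k(G^{t_0}_t)B_{t_0}]_+^{\cdot k}\bigr)G^{t_0}_t;\] (5) for each $t\in\mathbb{T}_n$ and $i,j,k$, the $k$-th rows of $G^{t_0}_t$ and $\tilde G^{t_0}_t$ are sign-coherent with $\varepsilon_k(G^{t_0}_t)=\varepsilon_k(\tilde G^{t_0}_t)$, and the $i$-th row of $G^{t_0}_t$ is $\pm e_j$ if and only if the $i$-th row of $\tilde G^{t_0}_t$ is $\pm e_j$.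
   Context: For real $a$, $[a]_+=\max(a,0)$. An integer $n\times n$ matrix $B=(b_{ij})$ is sign-skew-symmetric if $b_{ij}b_{ji}\le0$ for all $i,j$ and $b_{ij}b_{ji}=0$ implies $b_{ij}=b_{ji}=0$. Its mutation at $k$ is $\mu_k(B)=(b'_{ij})$ with $b'_{ij}=-b_{ij}$ if $i=k$ or $j=k$, and $b'_{ij}=b_{ij}+\mathrm{sign}(b_{ik})[b_{ik}b_{kj}]_+$ otherwise. $B$ is totally sign-skew-symmetric if every matrix obtained from $B$ by finitely many mutations is sign-skew-symmetric; matrices mutation equivalent to an acyclic sign-skew-symmetric matrix are known to be totally sign-skew-symmetric. $B$ is acyclic if the directed graph on $\{1,\dots,n\}$ with an arrow $i\to j$ whenever $b_{ij}>0$ has no oriented cycle. $\mathbb{T}_n$ is the $n$-regular tree with edges labeled by $1,\dots,n$, distinct labels at each vertex; $t\overset{k}{\text{---}}t'$ is an edge labeled $k$. An exchange matrix pattern assigns to each $t$ a totally sign-skew-symmetric $B_t$ with $B_{t'}=\mu_k(B_t)$ whenever $t\overset{k}{\text{---}}t'$; then $(-B_t^T)$ is also one. Notation for $n\times n$ matrices $A$: $[A]_+$ entrywise positive part; $A^{k\cdot}$ keeps only the $k$-th row; $A^{\cdot k}$ keeps only the $k$-th column; $J_k$ is the identity with $(k,k)$ entry $-1$; $e_j$ is the $j$-th standard basis vector. For a pattern $(M_t)$ and initial vertex $t_0$, its $C$-matrices $C^{t_0}_t$ and $G$-matrices $G^{t_0}_t$ are defined by $C^{t_0}_{t_0}=G^{t_0}_{t_0}=I_n$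 and, along the path from $t_0$, for each edge $t\overset{k}{\text{---}}t'$ with $t$ closer to $t_0$: $C^{t_0}_{t'}=C^{t_0}_t(J_k+[M_t]_+^{k\cdot})+[-C^{t_0}_t]_+^{\cdot k}M_t$, $G^{t_0}_{t'}=G^{t_0}_t(J_k+[-M_t]_+^{\cdot k})-M_{t_0}[-C^{t_0}_t]_+^{\cdot k}$ (the $C$- and $G$-matrices of the cluster algebra with principal coefficients and initial exchange matrix $M_{t_0}$). Every column of every $C$-matrix is known to be nonzero and sign-coherent; $\varepsilon_k(C)$ is the sign of its $k$-th column, and for a matrix $G$ whose $k$-th row is sign-coherent, $\varepsilon_k(G)$ is the sign of that row. $C^{t_0}_t,G^{t_0}_t$ refer to the pattern $(B_t)$ and $\tilde C^{t_0}_t,\tilde G^{t_0}_t$ to the pattern $(-B_t^T)$. *)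

(* Defs.v *)
From HB Require Import structures.
From mathcomp Require Import all_boot all_order all_algebra.
Set Implicit Arguments.
Unset Strict Implicit.
Unset Printing Implicit Defensive.
Import Order.TTheory GRing.Theory Num.Theory.
Local Open Scope ring_scope.

Section Matrices.
Variable n : nat.
Implicit Types (A B : 'M[int]_n) (k : 'I_n).

Definition pos_part (a : int) : int := Num.max a 0.

Definition pos_mx A : 'M[int]_n := map_mx pos_part A.

Definition only_row k A : 'M[int]_n :=
  \matrix_(i, j) (if i == k then A i j else 0).

Definition only_col k A : 'M[int]_n :=
  \matrix_(i, j) (if j == k then A i j else 0).

Definition J_mx k : 'M[int]_n := diag_mx (\row_i (if i == k then -1 else 1)).

(* The case i = j forces a zero diagonal. *)
Definition sign_skew_symmetric B : Prop :=
  forall i j, B i j * B j i <= 0 /\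
              (B i j * B j i = 0 -> B i j = 0 /\ B j i = 0).

Definition mutate k B : 'M[int]_n :=
  \matrix_(i, j)
    (if (i == k) || (j == k) then - B i j
     else B i j + Num.sg (B i k) * pos_part (B i k * B k j)).

Lemma mutateK k : involutive (mutate k).
Proof.
move=> B; apply/matrixP => i j; rewrite !mxE eqxx !orbT /=.
by case: (_ || _); rewrite ?opprK // mulrNN sgrN mulNr addrK.
Qed.

Definition mutate_seq B (s : seq 'I_n) : 'M[int]_n :=
  foldl (fun A k => mutate k A) B s.

(* Symmetric in A and B by mutateK. *)
Definition mutation_equivalent B A : Prop :=
  exists s : seq 'I_n, mutate_seq B s = A.

Definition totally_sign_skew_symmetric B : Prop :=
  forall s : seq 'I_n, sign_skew_symmetric (mutate_seq B s).

Definition arrow B : rel 'I_n := fun i j => 0 < B i j.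

(* [cycle e c] is vacuously true for the empty sequence. *)
Definition acyclic B : Prop :=
  forall c : seq 'I_n, cycle (arrow B) c -> c = [::].

Definition sign_coherent (v : 'I_n -> int) : Prop :=
  (forall i, 0 <= v i) \/ (forall i, v i <= 0).

(* The sign of a nonzero sign-coherent vector; 0 stands for "undefined", i.e.
   the vector is zero or has entries of both signs. *)
Definition vec_sign (v : 'I_n -> int) : int :=
  if [exists i, 0 < v i] && [forall i, 0 <= v i] then 1
  else if [exists i, v i < 0] && [forall i, v i <= 0] then -1
  else 0.

Definition eps_col k A : int := vec_sign (fun i => A i k).

Definition eps_row k A : int := vec_sign (fun j => A k j).

Definition col_pm_unit A (i j : 'I_n) : Prop :=
  col i A = delta_mx j 0 \/ col i A = - delta_mx j 0.

Definition row_pm_unit A (i j : 'I_n) : Prop :=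
  row i A = delta_mx 0 j \/ row i A = - delta_mx 0 j.

End Matrices.

(* The n-regular tree is realised as the Cayley graph of the free product of n
   copies of Z/2: a vertex is the reduced word of the edge labels on its path
   from a base vertex [::], the last label crossed coming first. *)
Section Tree.
Variable n : nat.
Implicit Types (w : seq 'I_n) (k : 'I_n).

Definition reduced w : bool := sorted (fun a b : 'I_n => a != b) w.

Definition nbr_word k w : seq 'I_n :=
  if w is a :: w' then if a == k then w' else k :: w else [:: k].

Lemma nbr_word_reduced k w : reduced w -> reduced (nbr_word k w).
Proof.
case: w => [//|a w] /= Hw; case: (eqVneq a k) => [_|ak].
  by move: Hw; case: w => //= b w /andP[].
by rewrite /= eq_sym ak.
Qed.

Lemma nbr_wordK k w : reduced w -> nbr_word k (nbr_word k w) = w.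
Proof.
case: w => [|a w] /= Hw; first by rewrite eqxx.
case: (eqVneq a k) => [<-|ak] /=; last by rewrite eqxx.
case: w Hw => [//|b w] /= /andP[ab _].
by rewrite eq_sym (negPf ab).
Qed.

Definition vertex := {w : seq 'I_n | reduced w}.

Implicit Types t : vertex.

Definition nbr k t : vertex :=
  exist _ (nbr_word k (val t)) (nbr_word_reduced k (valP t)).

Definition edge k t t' : Prop := t' = nbr k t.

(* The labels of the path from t0 to t, last one first: the reduced form of the
   product of the word t with the inverse of the word t0. *)
Definition geodesic t0 t : seq 'I_n :=
  foldr nbr_word (rev (val t0)) (val t).

Definition tree_dist t0 t : nat := size (geodesic t0 t).

Lemma nbrK k t : nbr k (nbr k t) = t.
Proof. by apply: val_inj; apply: nbr_wordK (valP t). Qed.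

Lemma geodesic_id t : geodesic t t = [::].
Proof.
rewrite /geodesic -[rev _]cats0; elim: (val t) [::] => [//|a w IHw] s /=.
by rewrite rev_cons cat_rcons IHw /= eqxx.
Qed.

Lemma geodesic_reduced t0 t : reduced (geodesic t0 t).
Proof.
rewrite /geodesic; elim: (val t) => [|a w IHw] /=; last exact: nbr_word_reduced.
rewrite /reduced rev_sorted; have := valP t0; rewrite /reduced.
by congr is_true; apply: eq_sorted => a b; rewrite eq_sym.
Qed.

Lemma geodesic_nbr k t0 t : geodesic t0 (nbr k t) = nbr_word k (geodesic t0 t).
Proof.
have nil_w s : reduced s -> reduced (foldr nbr_word (rev (val t0)) s).
  by move=> rs; apply: (geodesic_reduced t0 (exist _ s rs)).
case: t => [[|a w] Hw] //; rewrite /geodesic /=.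
case: (eqVneq a k) => [<-|//]; rewrite nbr_wordK //.
by apply: nil_w; move: Hw; case: w => //= b w /andP[].
Qed.

Lemma foldr_nbr_word k t0 w :
  foldr nbr t0 (nbr_word k w) = nbr k (foldr nbr t0 w).
Proof.
by case: w => [//|a w] /=; case: (eqVneq a k) => [->|//]; rewrite nbrK.
Qed.

Lemma foldr_nbr_geodesic t0 t : foldr nbr t0 (geodesic t0 t) = t.
Proof.
have root w : reduced w -> forall t1, val t1 = [::] -> val (foldr nbr t1 w) = w.
  elim: w => [//|a w IHw] Hw t1 Ht1 /=; rewrite IHw //.
    by case: w Hw {IHw} => [//|b w] /= /andP[ab _]; rewrite eq_sym (negPf ab).
  by move: Hw; case: (w) => //= b s /andP[].
have back : val (foldr nbr t0 (rev (val t0))) = [::].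
  suff H w t1 : val t1 = w -> val (foldr nbr t1 (rev w)) = [::] by exact: H.
  elim: w t1 => [//|a w IHw] t1 Ht1; rewrite rev_cons foldr_rcons.
  by apply: IHw; rewrite /= Ht1 /= eqxx.
apply: val_inj; rewrite -[RHS](root _ (valP t) _ back); congr (val _).
by rewrite /geodesic; elim: (val t) => [//|a w IHw] /=; rewrite foldr_nbr_word IHw.
Qed.

End Tree.

Section Patterns.
Variable n : nat.
Implicit Types (M B : vertex n -> 'M[int]_n) (t : vertex n).

Definition exchange_pattern B : Prop :=
  (forall t, totally_sign_skew_symmetric (B t)) /\
  (forall k t t', edge k t t' -> B t' = mutate k (B t)).

Definition neg_tr B : vertex n -> 'M[int]_n := fun t => - (B t)^T.

Definition C_step k (Mt C : 'M[int]_n) : 'M[int]_n :=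
  C *m (J_mx k + only_row k (pos_mx Mt)) + only_col k (pos_mx (- C)) *m Mt.

Definition G_step k (Mt0 Mt C G : 'M[int]_n) : 'M[int]_n :=
  G *m (J_mx k + only_col k (pos_mx (- Mt))) - Mt0 *m only_col k (pos_mx (- C)).

(* The pair (C, G) at the end of the walk from t0 with labels p (last first). *)
Fixpoint CG_along M t0 (p : seq 'I_n) : 'M[int]_n * 'M[int]_n :=
  if p is k :: p' then
    let: (C, G) := CG_along M t0 p' in
    let t := foldr (@nbr n) t0 p' in
    (C_step k (M t) C, G_step k (M t0) (M t) C G)
  else (1%:M, 1%:M).

Definition Cmat M t0 t : 'M[int]_n := (CG_along M t0 (geodesic t0 t)).1.

Definition Gmat M t0 t : 'M[int]_n := (CG_along M t0 (geodesic t0 t)).2.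

(* The next two lemmas are the defining recursion of the C- and G-matrices. *)
Lemma CGmat_id M t0 : Cmat M t0 t0 = 1%:M /\ Gmat M t0 t0 = 1%:M.
Proof. by rewrite /Cmat /Gmat geodesic_id. Qed.

Lemma CGmat_edge M t0 k t t' :
  edge k t t' -> (tree_dist t0 t < tree_dist t0 t')%N ->
  Cmat M t0 t' = C_step k (M t) (Cmat M t0 t) /\
  Gmat M t0 t' = G_step k (M t0) (M t) (Cmat M t0 t) (Gmat M t0 t).
Proof.
move=> ->; rewrite /tree_dist /Cmat /Gmat geodesic_nbr => lt_d.
have -> : nbr_word k (geodesic t0 t) = k :: geodesic t0 t.
  move: lt_d; case: (geodesic t0 t) => [//|a w] /=.
  by case: (a == k) => //; rewrite ltnNge leqnSn.
by rewrite /= foldr_nbr_geodesic; case: (CG_along _ _ _).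
Qed.

End Patterns.

(* Main.v *)
Require Import Defs.
From mathcomp Require Import all_boot all_order all_algebra.
From mathcomp Require Import ring zify.
Set Implicit Arguments.
Unset Strict Implicit.
Unset Printing Implicit Defensive.
Import Order.TTheory GRing.Theory Num.Theory.
Local Open Scope ring_scope.

(** Sign-coherence of the C-matrices, equality of the signs of C and C~, and
the coincidence of their columns of the form +-e_k are proved together, for all
totally sign-skew-symmetric initial matrices, by induction on the length of the
walk.  As long as they hold for shorter walks, both C and G are products of
elementary matrices, whence G^T C~ = 1.

Row k of G is controlled through the Laurent phenomenon with principal
coefficients.  Put 1 for the initial cluster variables (at t0, or at the
neighbour of t0 in direction k), keep y = y_k, and let every other y_m tend to 0.
One of the two terms of an exchange relation dies in the limit unless the mutated
column of C is +-e_k, so each cluster variable tends to a power of 1 + y.  The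
exponents are 0 in one of the two charts and the entries of +- row k of G in the
other one; since the limit is a Laurent polynomial, they are nonnegative, so
row k of G is sign-coherent.  Its sign changes exactly when the mutated column of
C is +-e_k.

This sign governs how C and G change under a move of the initial vertex, which
yields the duality G(B, p)^T = C(B_p^T, reversed p).  By duality, sign-coherence
of the rows of G becomes sign-coherence of the columns of C for walks that are
one step longer.  If a column of C~, but not that of C, were +-e_k, one more
mutation would produce a negative exponent. *)

(** * Laurent functions on the positive orthant *)

Section LaurentFunctions.
Variables (F : realFieldType) (N : nat).
Implicit Types (v : 'rV[F]_N) (a b phi : 'rV[int]_N).
Implicit Types (s t : seq (F * 'rV[int]_N)) (f g w : 'rV[F]_N -> F).

Definition positive v := forall i, 0 < v 0 i.

Definition mon v a : F := \prod_i v 0 i ^ a 0 i.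

Definition ev s v : F := \sum_(e <- s) e.1 * mon v e.2.

(** Laurent polynomials are handled as functions on positive points, where no denominator vanishes.
    The list of terms need not be reduced; only its values count. *)
Definition Laur f := exists s, forall v, positive v -> f v = ev s v.

Lemma mon_gt0 v a : positive v -> 0 < mon v a.
Proof. by move=> v0; apply: prodr_gt0 => i _; apply: exprz_gt0. Qed.

Lemma mon_neq0 v a : positive v -> mon v a != 0.
Proof. by move=> v0; rewrite gt_eqF ?mon_gt0. Qed.

Lemma mon0 v : mon v 0 = 1.
Proof. by rewrite /mon big1 // => i _; rewrite mxE expr0z. Qed.

Lemma monD v a b : positive v -> mon v (a + b) = mon v a * mon v b.
Proof.
move=> v0; rewrite /mon -big_split; apply: eq_bigr => i _ /=.
by rewrite mxE expfzDr // gt_eqF.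
Qed.

Lemma monN v a : mon v (- a) = (mon v a)^-1.
Proof. by rewrite /mon -prodfV; apply: eq_bigr => i _; rewrite mxE -invr_expz. Qed.

Lemma mon_delta v i : mon v (delta_mx 0 i) = v 0 i.
Proof.
rewrite /mon (bigD1 i) //= big1 ?mulr1 => [|j /negPf ji].
  by rewrite mxE !eqxx expr1z.
by rewrite mxE ji andbF expr0z.
Qed.

Lemma Laur_ext f g : (forall v, positive v -> f v = g v) -> Laur g -> Laur f.
Proof. by move=> fg [s gs]; exists s => v v0; rewrite fg ?gs. Qed.

Lemma Laur_ev s : Laur (ev s).
Proof. by exists s. Qed.

Lemma Laur_mon c a : Laur (fun v => c * mon v a).
Proof. by exists [:: (c, a)] => v _; rewrite /ev big_seq1. Qed.

Lemma Laur_mon1 a : Laur (fun v => mon v a).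
Proof. by apply: Laur_ext (Laur_mon 1 a) => v _; rewrite mul1r. Qed.

Lemma Laur_const c : Laur (fun=> c).
Proof. by apply: Laur_ext (Laur_mon c 0) => v _; rewrite mon0 mulr1. Qed.

Lemma Laur_coord i : Laur (fun v => v 0 i).
Proof. by apply: Laur_ext (Laur_mon1 (delta_mx 0 i)) => v _; rewrite mon_delta. Qed.

Lemma Laur_coordV i : Laur (fun v => (v 0 i)^-1).
Proof.
by apply: Laur_ext (Laur_mon1 (- delta_mx 0 i)) => v _; rewrite monN mon_delta.
Qed.

Lemma ev_cat s t v : ev (s ++ t) v = ev s v + ev t v.
Proof. by rewrite /ev big_cat. Qed.

Definition mulL s t := [seq (x.1 * y.1, x.2 + y.2) | x <- s, y <- t].

Lemma ev_mul s t v : positive v -> ev (mulL s t) v = ev s v * ev t v.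
Proof.
move=> v0; rewrite /ev /mulL big_allpairs_dep big_distrl /=; apply: eq_bigr => x _.
rewrite big_distrr /=; apply: eq_bigr => y _; rewrite monD //; ring.
Qed.

Lemma LaurD f g : Laur f -> Laur g -> Laur (fun v => f v + g v).
Proof.
move=> [s fs] [t gt]; exists (s ++ t) => v v0.
by rewrite ev_cat fs ?gt.
Qed.

Lemma LaurM f g : Laur f -> Laur g -> Laur (fun v => f v * g v).
Proof.
move=> [s fs] [t gt]; exists (mulL s t) => v v0.
by rewrite ev_mul // fs ?gt.
Qed.

Lemma LaurN f : Laur f -> Laur (fun v => - f v).
Proof.
move=> fL; apply: Laur_ext (LaurM (Laur_const (-1)) fL) => v _; by rewrite mulN1r.
Qed.

Lemma LaurB f g : Laur f -> Laur g -> Laur (fun v => f v - g v).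
Proof. by move=> fL gL; apply: LaurD fL (LaurN gL). Qed.

Lemma LaurX f n : Laur f -> Laur (fun v => f v ^+ n).
Proof.
move=> fL; elim: n => [|n IHn]; first exact: Laur_const.
by apply: Laur_ext (LaurM fL IHn) => v _; rewrite exprS.
Qed.

Lemma Laur_sum (I : Type) (r : seq I) (fs : I -> 'rV[F]_N -> F) :
  (forall i, Laur (fs i)) -> Laur (fun v => \sum_(i <- r) fs i v).
Proof.
move=> fL; elim: r => [|i r IHr].
  by apply: Laur_ext (Laur_const 0) => v _; rewrite big_nil.
by apply: Laur_ext (LaurD (fL i) IHr) => v _; rewrite big_cons.
Qed.

Definition deg phi a : int := \sum_i phi 0 i * a 0 i.

Definition part phi (d : int) s := [seq e <- s | deg phi e.2 == d].

Lemma degD phi a b : deg phi (a + b) = deg phi a + deg phi b.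
Proof.
by rewrite /deg -big_split; apply: eq_bigr => i _; rewrite mxE mulrDr.
Qed.

(** One-parameter torus action that turns the grading [phi] into powers of [tau]. *)
Definition scale phi (tau : F) v : 'rV[F]_N := \row_i (v 0 i * tau ^ phi 0 i).

Lemma scale_pos phi tau v : 0 < tau -> positive v -> positive (scale phi tau v).
Proof. by move=> t0 v0 i; rewrite mxE mulr_gt0 ?exprz_gt0. Qed.

Lemma mon_scale phi tau v a : 0 < tau -> positive v ->
  mon (scale phi tau v) a = mon v a * tau ^ deg phi a.
Proof.
move=> t0 v0; have tn0 : tau != 0 by rewrite gt_eqF.
have -> : tau ^ deg phi a = \prod_i tau ^ (phi 0 i * a 0 i).
  rewrite /deg; elim/big_rec2: _ => [|i x y _ <-]; first by rewrite expr0z.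
  by rewrite expfzDr.
rewrite /mon -big_split; apply: eq_bigr => i _ /=.
by rewrite mxE expfzMl -exprz_exp.
Qed.

Lemma poly_pos_eq0 (q : {poly F}) : (forall tau, 0 < tau -> q.[tau] = 0) -> q = 0.
Proof.
move=> q0; apply: (roots_geq_poly_eq0 (rs := [seq i.+1%:R | i <- iota 0 (size q)])).
- by apply/allP => x /mapP[i _ ->]; rewrite /root q0 ?ltr0Sn.
- rewrite map_inj_uniq ?iota_uniq // => i j /eqP; rewrite eqr_nat => /eqP[] //.
- by rewrite size_map size_iota.
Qed.

(** Along the orbit of [v] under [scale phi tau], [ev s] is a Laurent polynomial in [tau] vanishing
    for all [tau > 0], and its coefficients are the homogeneous parts. Hence these parts depend only
    on the function, not on the list of terms. *)
Lemma ev_part_eq0 phi d s : (forall v, positive v -> ev s v = 0) ->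
  forall v, positive v -> ev (part phi d s) v = 0.
Proof.
move=> s0 v v0.
(* The shift by [K] makes all exponents of [tau] nonnegative. *)
pose K : nat := (`|d| + \sum_(e <- s) `|deg phi e.2|)%N.
have Kd : 0 <= d + K%:Z by rewrite /K; lia.
have Ks e : e \in s -> 0 <= deg phi e.2 + K%:Z.
  move=> es; suff: (`|deg phi e.2| <= \sum_(e <- s) `|deg phi e.2|)%N.
    by rewrite /K; lia.
  by rewrite (big_rem e) //= leq_addr.
pose q : {poly F} := \sum_(e <- s) (e.1 * mon v e.2) *: 'X^(absz (deg phi e.2 + K%:Z)).
have q0 : q = 0.
  apply: poly_pos_eq0 => tau t0; have tn0 : tau != 0 by rewrite gt_eqF.
  suff -> : q.[tau] = tau ^ K%:Z * ev s (scale phi tau v).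
    by rewrite s0 ?mulr0 //; apply: scale_pos.
  rewrite /q horner_sum /ev big_distrr /=; apply: eq_big_seq => e es.
  rewrite hornerZ hornerXn mon_scale // exprnP.
  have -> : tau ^ (absz (deg phi e.2 + K%:Z))%:Z = tau ^ (deg phi e.2 + K%:Z).
    by rewrite gez0_abs // Ks.
  by rewrite expfzDr // [RHS]mulrC !mulrA.
have := congr1 (fun p : {poly F} => p`_(absz (d + K%:Z))) q0.
rewrite coef0 => <-; rewrite /q coef_sum /ev /part big_filter big_mkcond /=.
apply: eq_big_seq => e es; rewrite coefZ coefXn.
have -> : (absz (d + K%:Z) == absz (deg phi e.2 + K%:Z)) = (deg phi e.2 == d).
  by move: (deg phi e.2) (Ks _ es) Kd => x Ke Kd; apply/eqP/eqP; lia.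
by case: eqP; rewrite ?mulr1 ?mulr0.
Qed.

Lemma ev_part_eq phi d s t : (forall v, positive v -> ev s v = ev t v) ->
  forall v, positive v -> ev (part phi d s) v = ev (part phi d t) v.
Proof.
move=> st v v0; pose t' := [seq (- e.1, e.2) | e <- t].
have evt' r u : ev [seq (- e.1, e.2) | e <- r] u = - ev r u.
  by rewrite /ev big_map -sumrN; apply: eq_bigr => e _; rewrite mulNr.
have: ev (part phi d (s ++ t')) v = 0.
  by apply: ev_part_eq0 => // u u0; rewrite ev_cat evt' st ?subrr.
rewrite /part filter_cat ev_cat filter_map evt' => /eqP; rewrite subr_eq0 => /eqP -> //.
Qed.

Lemma min_deg phi s : s != [::] ->
  exists2 x, x \in s & all (fun e => deg phi x.2 <= deg phi e.2) s.
Proof.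
elim: s => // y s IHs _; case: (altP (s =P [::])) => [->|/IHs[z zs zmin]].
  by exists y; rewrite ?mem_head //= lexx.
case: (lerP (deg phi y.2) (deg phi z.2)) => [yz|/ltW zy].
  exists y; rewrite ?mem_head //= lexx; apply/allP => u /(allP zmin); exact: le_trans.
by exists z; rewrite ?inE ?zs ?orbT //= zy.
Qed.

(* A is not a zero divisor modulo P in the ring of Laurent functions. *)
Definition nzd (A P : 'rV[F]_N -> F) :=
  forall w, Laur w -> Laur (fun v => A v * w v / P v) -> Laur (fun v => w v / P v).

Lemma ev_part_mul phi d0 d s t v : all (fun e => deg phi e.2 == d0) s -> positive v ->
  ev (part phi (d0 + d) (mulL s t)) v = ev s v * ev (part phi d t) v.
Proof.
move=> s0 v0; rewrite -ev_mul //; congr (ev _ v); rewrite /mulL /part.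
elim: s s0 => //= x s IHs /andP[/eqP x0 s0]; rewrite filter_cat IHs //; congr (_ ++ _).
by rewrite filter_map; congr map; apply: eq_filter => y /=; rewrite degD x0 (inj_eq (addrI _)).
Qed.

(* The extremal part of A for the grading phi is a single term, hence a unit,
   while P is homogeneous: peel off the lowest part of w. *)
Lemma nzd_extremal phi (A P B : 'rV[F]_N -> F) sP d0 c a s1 :
    (forall v, positive v -> P v != 0) -> (forall v, positive v -> P v = ev sP v) ->
    all (fun e => deg phi e.2 == d0) sP -> c != 0 ->
    all (fun e => deg phi a < deg phi e.2) s1 -> Laur B ->
    (forall v, positive v -> A v = c * mon v a + ev s1 v + P v * B v) ->
  nzd A P.
Proof.
move=> Pn0 PE P0 c0 s10 BL AE w [s ws].
elim: {s}(size s) {-2}s (leqnn (size s)) w ws => [|m IHm] s.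
  rewrite leqn0 size_eq0 => /eqP-> w ws _.
  by apply: Laur_ext (Laur_const 0) => v v0; rewrite ws // /ev big_nil mul0r.
move=> sm w ws AwL.
case: (altP (s =P [::])) => [s0|sn0].
  by apply: Laur_ext (Laur_const 0) => v v0; rewrite ws // s0 /ev big_nil mul0r.
have [x xs xmin] := min_deg phi sn0.
have AwL' : Laur (fun v => (c * mon v a + ev s1 v) * w v / P v).
  apply: Laur_ext (LaurB AwL (LaurM BL (Laur_ev s))) => v v0.
  rewrite AE // -ws //; have := Pn0 v v0; by move=> ?; field.
have [g gE] := AwL'.
set d := deg phi x.2 in xmin.
pose lo := part phi d s; pose hi := [seq e <- s | deg phi e.2 != d].
have s_split v : ev s v = ev lo v + ev hi v.
  by rewrite /lo /hi /part /ev !big_filter (bigID (fun e => deg phi e.2 == d)).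
(* Compare the parts of degree [deg phi a + d] in [(A - P * B) * w = P * g]: on the left only the
   product of the two lowest parts survives. *)
have loE v : positive v -> c * mon v a * ev lo v = P v * ev (part phi (deg phi a + d - d0) g) v.
  move=> v0; rewrite PE // -(ev_part_mul _ _ P0) // addrC subrK.
  have <- : ev (part phi (deg phi a + d) (mulL ((c, a) :: s1) s)) v =
            c * mon v a * ev lo v.
    rewrite -(_ : ev [:: (c, a)] v = c * mon v a); last by rewrite /ev big_seq1.
    rewrite -ev_mul // /mulL /= cats0 /part filter_cat.
    rewrite [X in _ ++ X](_ : _ = [::]) ?cats0; last first.
      apply/eqP; rewrite -(negbK (_ == _)) -has_filter; apply/hasPn => u.
      case/allpairsP=> -[p q] /= [ps qs ->] /=.
      rewrite degD gt_eqF // ltr_leD ?(allP s10) ?(allP xmin) //.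
    rewrite /lo /part filter_map; congr (ev (map _ _) v).
    by apply: eq_filter => y /=; rewrite degD (inj_eq (addrI _)).
  apply: ev_part_eq => // u u0; rewrite !ev_mul // -gE // -PE // -ws //.
  rewrite {1}/ev big_cons -/(ev s1 u) /=.
  have := Pn0 u u0; by move=> ?; field.
have loL : Laur (fun v => ev lo v / P v).
  apply: Laur_ext (LaurM (Laur_mon c^-1 (- a)) (Laur_ev (part phi (deg phi a + d - d0) g))).
  move=> v v0; apply: (mulfI c0); apply: (mulfI (mon_neq0 a v0)).
  rewrite monN !mulrA -[mon v a * c]mulrC loE //.
  have mn0 := mon_neq0 a v0; have := Pn0 v v0 => Pv.
  by field; rewrite c0 mn0.
have hiL : Laur (fun v => ev hi v / P v).
  apply: (IHm hi) => //.
    rewrite -ltnS; apply: leq_trans sm.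
    rewrite /hi size_filter -(count_predC (fun e => deg phi e.2 != d) s).
    rewrite -[ltnLHS]addn0 ltn_add2l -has_count; apply/hasP; exists x => //=; by rewrite negbK.
  have ABL := LaurD (LaurD (Laur_mon c a) (Laur_ev s1)) (LaurM (Laur_ev sP) BL).
  apply: Laur_ext (LaurB AwL (LaurM ABL loL)) => v v0.
  rewrite ws // s_split -PE // AE //; have := Pn0 v v0; by move=> ?; field.
by apply: Laur_ext (LaurD loL hiL) => v v0; rewrite ws // s_split mulrDl.
Qed.

Lemma nzdX A P n : (forall v, positive v -> P v != 0) -> Laur A -> nzd A P ->
  nzd (fun v => A v ^+ n) P.
Proof.
move=> Pn0 AL AP; elim: n => [|n IHn] w wL.
  by apply: Laur_ext => v _; rewrite expr0 mul1r.
move=> h; apply: IHn => //.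
apply: Laur_ext (AP (fun v => A v ^+ n * w v) (LaurM (LaurX n AL) wL) _) => //.
by apply: Laur_ext h => v v0; rewrite exprS !mulrA.
Qed.

Lemma nzdM A A' P : Laur A' ->
  nzd A P -> nzd A' P -> nzd (fun v => A v * A' v) P.
Proof.
move=> AL AP AP' w wL h; apply: AP' => //.
apply: (AP (fun v => A' v * w v)); first exact: LaurM.
by apply: Laur_ext h => v v0; rewrite !mulrA.
Qed.

(** One factor [P] is removed at a time: [A ^+ n * (z * P ^+ m.+1) / P] is the product of
    [z * A ^+ n] and [P ^+ m], hence Laurent, and the power of [A] can be cancelled. This takes the
    place of unique factorization with coprime denominators. *)
Lemma Laur_clear A P z m n : (forall v, positive v -> P v != 0) -> Laur A -> Laur P ->
  nzd A P -> Laur (fun v => z v * P v ^+ m) -> Laur (fun v => z v * A v ^+ n) -> Laur z.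
Proof.
move=> Pn0 AL PL AP; elim: m => [|m IHm] zP zA.
  by apply: Laur_ext zP => v _; rewrite expr0 mulr1.
apply: IHm => //.
apply: Laur_ext (nzdX (n := n) Pn0 AL AP zP _) => [v v0|].
  by rewrite exprS; have := Pn0 v v0 => ?; field.
apply: Laur_ext (LaurM zA (LaurX m PL)) => v v0.
by rewrite exprS; have := Pn0 v v0 => ?; field.
Qed.

End LaurentFunctions.

(** * Substitution into Laurent functions *)

Section Composition.
Variables (F : realFieldType) (N M : nat).

Lemma Laur_prod (I : Type) (r : seq I) (fs : I -> 'rV[F]_M -> F) :
  (forall i, Laur (fs i)) -> Laur (fun v => \prod_(i <- r) fs i v).
Proof.
move=> fL; elim: r => [|i r IHr].
  by apply: Laur_ext (Laur_const _ 1) => v _; rewrite big_nil.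
by apply: Laur_ext (LaurM (fL i) IHr) => v _; rewrite big_cons.
Qed.

(** Each negative power of a coordinate of [g v] is made Laurent by the corresponding power of [Q],
    because the quotient of [Q] by that coordinate is Laurent. *)
Lemma Laur_comp (f : 'rV[F]_N -> F) (g : 'rV[F]_M -> 'rV[F]_N) (Q : 'rV[F]_M -> F) :
    Laur f -> (forall v, positive v -> positive (g v)) ->
    (forall i, Laur (fun v => g v 0 i)) -> Laur Q ->
    (forall i, Laur (fun v => Q v / g v 0 i)) ->
  exists m, Laur (fun v => f (g v) * Q v ^+ m).
Proof.
move=> [s fs] g0 gL QL QgL.
suff [m h] : exists m, Laur (fun v => ev s (g v) * Q v ^+ m).
  by exists m; apply: Laur_ext h => v v0; rewrite fs //; apply: g0.
elim: s {fs} => [|[c a] s [m IHs]].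
  by exists 0%N; apply: Laur_ext (Laur_const _ 0) => v v0; rewrite /ev big_nil mul0r.
have monL : Laur (fun v => mon (g v) a * Q v ^+ (\sum_i absz (a 0%R i))).
  apply: (@Laur_ext _ _ _ (fun v => \prod_i (g v 0 i ^ a 0 i * Q v ^+ absz (a 0%R i)))).
    by move=> v v0; rewrite big_split /= prodrXr.
  apply: Laur_prod => i; case: (a 0 i) => n /=.
    by apply: LaurM; apply: LaurX.
  apply: Laur_ext (LaurX n.+1 (QgL i)) => v v0.
  by rewrite NegzE -exprnN exprMn exprVn mulrC.
exists (m + \sum_i absz (a 0%R i))%N.
apply: Laur_ext (LaurD (LaurM (LaurM (Laur_const _ c) monL) (LaurX m QL))
                       (LaurM IHs (LaurX (\sum_i absz (a 0%R i)) QL))) => v v0.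
rewrite /ev big_cons /= exprD; ring.
Qed.
End Composition.

(** * Cluster mutation and the Laurent phenomenon *)

Section PointMutation.
Variables (F : realFieldType) (N : nat).
Implicit Types (v : 'rV[F]_N) (a : 'rV[int]_N) (E : 'M[int]_N) (i j k : 'I_N).

Definition expo E k : 'rV[int]_N := \row_i E i k.
Definition ppos E k : 'rV[int]_N := \row_i pos_part (E i k).
Definition pneg E k : 'rV[int]_N := \row_i pos_part (- E i k).

Definition exch E k v : F := mon v (ppos E k) + mon v (pneg E k).

(** Cluster mutation on values: a cluster is represented by the numbers its variables take at a
    positive point. [E] is square over all indices, frozen ones included, and its column [k] encodes
    the exchange relation. *)
Definition mutpt k E v : 'rV[F]_N :=
  \row_i (if i == k then exch E k v / v 0 k else v 0 i).

Lemma pos_part_id (x : int) : 0 <= x -> pos_part x = x.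
Proof. by move=> x0; rewrite /pos_part max_l. Qed.

Lemma pos_part0 (x : int) : x <= 0 -> pos_part x = 0.
Proof. by move=> x0; rewrite /pos_part max_r. Qed.

Lemma pos_partB (x : int) : pos_part x - pos_part (- x) = x.
Proof.
rewrite /pos_part; lia.
Qed.

Lemma exch_gt0 E k v : positive v -> 0 < exch E k v.
Proof. by move=> v0; rewrite addr_gt0 ?mon_gt0. Qed.

Lemma exch_neq0 E k v : positive v -> exch E k v != 0.
Proof. by move=> v0; rewrite gt_eqF ?exch_gt0. Qed.

Lemma Laur_exch E k : Laur (exch E k).
Proof. by apply: LaurD; apply: Laur_mon1. Qed.

Lemma mutpt_pos k E v : positive v -> positive (mutpt k E v).
Proof. by move=> v0 i; rewrite mxE; case: eqP => // _; rewrite divr_gt0 ?exch_gt0. Qed.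

Lemma mutptk k E v : mutpt k E v 0 k = exch E k v / v 0 k.
Proof. by rewrite mxE eqxx. Qed.

Lemma mutpt_neq k E v i : i != k -> mutpt k E v 0 i = v 0 i.
Proof. by move=> /negPf ik; rewrite mxE ik. Qed.

Lemma mon_mutpt k E v a : positive v ->
  mon (mutpt k E v) a = mon v a * (mutpt k E v 0 k / v 0 k) ^ a 0 k.
Proof.
move=> v0; have vk : v 0 k != 0 by rewrite gt_eqF.
rewrite /mon (bigD1 k) //= [in RHS](bigD1 k) //=.
have -> : \prod_(i | i != k) mutpt k E v 0 i ^ a 0 i = \prod_(i | i != k) v 0 i ^ a 0 i.
  by apply: eq_bigr => i ik; rewrite mutpt_neq.
rewrite [(_ / _) ^ _]expfzMl exprz_inv -invr_expz.
have : v 0 k ^ a 0 k != 0 by rewrite expfz_neq0.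
move: (mutpt k E v 0 k ^ a 0 k) (v 0 k ^ a 0 k) (\prod_(i | _) _) => x y z y0.
by field.
Qed.

Lemma mon_mutpt0 k E v a : positive v -> a 0 k = 0 -> mon (mutpt k E v) a = mon v a.
Proof. by move=> v0 a0; rewrite mon_mutpt // a0 expr0z mulr1. Qed.

Lemma exch_mutate E k v : exch (mutate k E) k v = exch E k v.
Proof.
rewrite /exch addrC; congr (mon v _ + mon v _); apply/rowP => i;
by rewrite !mxE eqxx orbT ?opprK.
Qed.

Lemma exch_mutpt E k v : positive v -> E k k = 0 -> exch E k (mutpt k E v) = exch E k v.
Proof.
by move=> v0 Ek; rewrite /exch !mon_mutpt0 // mxE Ek ?oppr0 pos_part0.
Qed.

Lemma mutptK k E v : positive v -> E k k = 0 ->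
  mutpt k (mutate k E) (mutpt k E v) = v.
Proof.
move=> v0 Ek; apply/rowP => i; have vk : v 0 k != 0 by rewrite gt_eqF.
case: (eqVneq i k) => [->|ik]; last by rewrite !mutpt_neq.
rewrite mutptk exch_mutate exch_mutpt // mutptk.
by have := exch_neq0 E k v0 => P0; field; rewrite vk P0.
Qed.

Lemma mutateN k E : mutate k (- E) = - mutate k E.
Proof.
apply/matrixP => i j; rewrite !mxE; case: ifP => // _.
by rewrite mulrNN sgrN mulNr opprD.
Qed.

Lemma exchN E k v : exch (- E) k v = exch E k v.
Proof.
rewrite /exch addrC; congr (mon v _ + mon v _); apply/rowP => i; by rewrite !mxE ?opprK.
Qed.

Lemma mutptN k E v : mutpt k (- E) v = mutpt k E v.
Proof. by apply/rowP => i; rewrite !mxE exchN. Qed.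

End PointMutation.

Ltac laur :=
  repeat first [ assumption | exact: Laur_mon1 | exact: Laur_coord | exact: Laur_coordV
               | exact: Laur_const | apply: LaurX | apply: LaurM ].

(** * The new variables along the mutations k, j, k *)

Section Caterpillar.
Variables (F : realFieldType) (N : nat).
Implicit Types (v : 'rV[F]_N) (a : 'rV[int]_N) (E : 'M[int]_N) (i j k : 'I_N).

Lemma monZ v (c : int) a : mon v (c *: a) = mon v a ^ c.
Proof.
rewrite /mon; elim/big_rec2: _ => [|i x y _ ->]; first by rewrite exp1rz.
by rewrite mxE expfzMl exprz_exp mulrC [c * _]mulrC mulrC.
Qed.

Lemma monB v a b : positive v -> mon v (a - b) = mon v a / mon v b.
Proof. by move=> v0; rewrite monD // monN. Qed.

Lemma mutate_mul_pos (u : int) (e : nat) :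
  Num.sg u * pos_part (u * - e%:Z) = - (e%:Z * pos_part (- u)).
Proof.
case: (lerP 0 u) => u0.
  rewrite [pos_part (- u)]pos_part0 ?oppr_le0 // [pos_part _]pos_part0 ?mulr0 ?oppr0 //.
  by rewrite mulrN oppr_le0 mulr_ge0.
rewrite ltr0_sg // !pos_part_id ?oppr_ge0 ?(ltW u0) //; first by ring.
by rewrite mulrN oppr_ge0 mulr_le0_ge0 // ltW.
Qed.

Lemma pos_partNn (m : nat) : pos_part (- m%:Z) = 0.
Proof. by rewrite pos_part0 // oppr_le0. Qed.

Lemma deg0 a : deg 0 a = 0.
Proof. by rewrite /deg big1 // => i _; rewrite mxE mul0r. Qed.

Lemma degNdelta k a : deg (- delta_mx 0 k) a = - a 0 k.
Proof.
rewrite /deg (bigD1 k) //= big1 ?addr0 => [|i /negPf ik].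
  by rewrite !mxE !eqxx mulN1r.
by rewrite !mxE ik andbF oppr0 mul0r.
Qed.

Lemma exch_ev E k v : exch E k v = ev [:: (1, ppos E k); (1, pneg E k)] v.
Proof. by rewrite /ev !big_cons big_nil /= !mul1r addr0. Qed.

(* The two steps k, j followed by k again: modulo the exchange polynomial P of
   the first step, the second new variable is a monomial and the third one is a
   monomial of degree 1 plus a term of degree 0 in the variable k. *)
Lemma caterpillar_pos E k j : k != j -> E k k = 0 -> E j j = 0 ->
    E k j < 0 -> 0 < E j k ->
  let E1 := mutate k E in let E2 := mutate j E1 in
  let v2 := fun v : 'rV[F]_N => mutpt j E1 (mutpt k E v) in
  let A := fun v => v2 v 0 j in let C := fun v => mutpt k E2 (v2 v) 0 k in
  [/\ Laur A, Laur C, nzd A (exch E k) & nzd C (exch E k)].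
Proof.
move=> kj Ekk Ejj Ekj Ejk E1 E2 v2 A C.
have jk : j != k by rewrite eq_sym.
have [b Eb] : exists b : nat, E k j = - b.+1%:Z by exists (absz (E k j)).-1; lia.
have [e Ee] : exists e : nat, E j k = e%:Z by exists (absz (E j k)); lia.
have E1kj : E1 k j = b.+1%:Z by rewrite mxE eqxx Eb opprK.
have E1jk : E1 j k = - e%:Z by rewrite mxE eqxx orbT Ee.
have E1jj : E1 j j = 0.
  by rewrite mxE (negPf jk) /= Ejj add0r Ee Eb mutate_mul_pos pos_partNn ?mulr0 ?oppr0.
have E1kk : E1 k k = 0 by rewrite mxE eqxx Ekk oppr0.
have E2jk : E2 j k = e%:Z by rewrite mxE eqxx E1jk opprK.
have E2kk : E2 k k = 0.
  by rewrite mxE (negPf kj) /= E1kk E1kj E1jk mutate_mul_pos pos_partNn ?mulr0 ?oppr0 ?addr0.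
have E1ik i : E1 i k = - E i k by rewrite mxE eqxx orbT.
have E2ik i : i != j -> E2 i k = E1 i k - e%:Z * pos_part (- E1 i j).
  by move=> /negPf ij; rewrite mxE ij (negPf kj) /= E1jk mutate_mul_pos.
clearbody E2; clearbody E1.
pose P := exch (F := F) E k; have Pn0 v : positive v -> P v != 0 by apply: exch_neq0.
have PL : Laur P by apply: Laur_exch.
pose x v := mutpt k E v 0 k.
have xE v : x v = P v / v 0 k by rewrite /x mutptk.
have xL : Laur x by apply: Laur_ext (LaurM PL (Laur_coordV _ k)) => v _; rewrite xE.
pose a1 := ppos E1 j - b.+1%:Z *: delta_mx 0 k.
pose nN := pneg E1 j.
have AE v : positive v -> A v = (mon v nN + mon v a1 * x v ^+ b.+1) / v 0 j.
  move=> v0; rewrite /A /v2 mutptk mutpt_neq // /exch; congr (_ / _).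
  rewrite addrC; congr (_ + _).
    by rewrite mon_mutpt0 // mxE E1kj pos_partNn.
  rewrite mon_mutpt // -/(x v) /a1 monB // monZ mon_delta mxE E1kj pos_part_id //.
  by rewrite -!exprnP expr_div_n mulrAC mulrA.
have vj0 v : positive v -> v 0 j != 0 by move=> v0; rewrite gt_eqF.
have vk0 v : positive v -> v 0 k != 0 by move=> v0; rewrite gt_eqF.
have AL : Laur A.
  apply: Laur_ext (LaurM (LaurD (Laur_mon1 _ nN) (LaurM (Laur_mon1 _ a1) (LaurX b.+1 xL)))
    (Laur_coordV _ j)) => v v0; exact: AE.
have Anzd : nzd A P.
  apply: (@nzd_extremal _ _ 0 A P (fun v => mon v a1 * x v ^+ b / v 0 k / v 0 j)
     [:: (1, ppos E k); (1, pneg E k)] 0 1 (nN - delta_mx 0 j) [::]) => //.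
  - by move=> v _; rewrite /P exch_ev.
  - by rewrite /= !deg0 eqxx.
  - exact: oner_neq0.
  - by apply: LaurM (Laur_coordV _ _); apply: LaurM (Laur_coordV _ _);
      apply: LaurM (Laur_mon1 _ _) (LaurX _ xL).
  move=> v v0; rewrite AE // (monB nN (delta_mx 0 j) v0) mon_delta /ev big_nil exprS {1}xE.
  by have := vj0 v v0; have := vk0 v v0 => vk vj; field; rewrite vk vj.
(* [y1] is the ratio of the two terms of [P], [z] that of the two terms of the second exchange
   relation, and [S] the geometric sum with [(1 + z) ^+ e = 1 + z * S]. *)
pose D2 v := mon v (pneg E2 k); pose D1 v := mon v (ppos E k).
pose y1 v := mon v (expo E1 k); pose R v := mon v (a1 - nN).
pose z v := R v * x v ^+ b.+1.
pose S v := \sum_(i < e) (1 + z v) ^+ i.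
have zL : Laur z by apply: LaurM (Laur_mon1 _ _) (LaurX _ xL).
have z1L : Laur (fun v => 1 + z v) by apply: LaurD (Laur_const _ 1) zL.
have SE v m : (1 + z v) ^+ m = 1 + z v * \sum_(i < m) (1 + z v) ^+ i.
  have := subrX1 (1 + z v) m; rewrite [1 + z v - 1]addrAC subrr add0r => <-.
  by rewrite [RHS]addrC subrK.
have SL m : Laur (fun v => \sum_(i < m) (1 + z v) ^+ i).
  by apply: Laur_sum => i; apply: LaurX z1L.
have y1E v : positive v -> P v = D1 v * (1 + y1 v).
  move=> v0; rewrite /P /exch mulrDr mulr1; congr (_ + _); rewrite /D1 /y1 -monD //.
  congr (mon v _); apply/rowP => i; rewrite !mxE E1ik.
  by have := pos_partB (E i k); lia.
(* This relation between the columns [k] of [E2] and [E1] makes the ratio of the two terms of the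
   third exchange relation equal to [y1 * (1 + z) ^+ e]. *)
have expE : expo E2 k + e%:Z *: nN - (e%:Z *+ 2) *: delta_mx 0 j = expo E1 k.
  apply/rowP => i; rewrite !mxE eqxx /=.
  case: (eqVneq i j) => [->|ij].
    by rewrite E2jk E1jj E1jk oppr0 pos_part0 //; lia.
  by rewrite E2ik //; lia.
have CE v : positive v ->
    C v = D2 v * v 0 k / D1 v + D2 v * y1 v * R v * x v ^+ b * S v.
  move=> v0; have v10 := mutpt_pos k E v0.
  have xn0 : x v != 0 by rewrite gt_eqF // /x.
  have D1n0 : D1 v != 0 by apply: mon_neq0.
  have nn0 : mon v nN != 0 by apply: mon_neq0.
  apply: (mulIf xn0); rewrite /C mutptk {2}/v2 mutpt_neq // -/(x v) divfK //.
  have D2E : mon (v2 v) (pneg E2 k) = D2 v.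
    by rewrite /v2 mon_mutpt0 // ?mon_mutpt0 // mxE ?E2jk ?E2kk ?oppr0 ?pos_partNn ?pos_part0.
  have -> : exch E2 k (v2 v) = D2 v * (1 + mon (v2 v) (expo E2 k)).
    rewrite -D2E /exch mulrDr mulr1 addrC -monD; last by apply: mutpt_pos.
    congr (_ + mon _ _); apply/rowP => i; rewrite !mxE.
    by rewrite -[X in _ = _ + X]pos_partB addrC subrK.
  have -> : mon (v2 v) (expo E2 k) = y1 v * (1 + z v) ^+ e.
    have e1 : mon (mutpt k E v) (expo E2 k) = mon v (expo E2 k) by rewrite mon_mutpt0 // mxE.
    have e2 : expo E2 k 0 j = e%:Z by rewrite mxE.
    have y1e : y1 v = mon v (expo E2 k) * mon v nN ^+ e / (v 0 j ^+ 2) ^+ e.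
      rewrite /y1 -expE (monB _ _ v0) (monD _ _ v0) !monZ mon_delta exprnP -exprM.
      by have -> : e%:Z *+ 2 = (2 * e)%N by rewrite mulr2n; lia.
    have AE' := AE v v0; rewrite /A /v2 in AE'.
    rewrite /v2 mon_mutpt // e1 e2 AE' mutpt_neq // y1e -exprnP.
    have -> : mon v nN + mon v a1 * x v ^+ b.+1 = mon v nN * (1 + z v).
      by rewrite /z /R (monB a1 nN v0); field.
    have := vj0 v v0 => vj.
    rewrite -[_ / _ / _]mulrA -invfM -expr2.
    by move: (v 0 j ^+ 2) => q; rewrite !exprMn exprVn; move: (q ^+ e)^-1 => r; ring.
  rewrite SE -/(S v) mulrDl.
  have -> : D2 v * v 0 k / D1 v * x v = D2 v * (1 + y1 v).
    by rewrite xE y1E //; have := vk0 v v0 => vk; field; rewrite D1n0 vk.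
  rewrite /z exprS; ring.
have CL : Laur C.
  apply: Laur_ext CE _; apply: LaurD.
    apply: (@Laur_ext _ _ _ (fun v => mon v (pneg E2 k) * v 0 k * mon v (- ppos E k))).
      by move=> v v0; rewrite monN.
    by apply: LaurM (Laur_mon1 _ _); apply: LaurM (Laur_mon1 _ _) (Laur_coord _ _).
  by have := SL e; laur.
split=> //.
have aE v : positive v -> D2 v * v 0 k / D1 v =
    1 * mon v (pneg E2 k + delta_mx 0 k - ppos E k).
  by move=> v0; rewrite mul1r monB // monD // mon_delta.
have degP : all (fun u : F * 'rV[int]_N => deg (- delta_mx 0 k) u.2 == 0)
    [:: (1, ppos E k); (1, pneg E k)].
  by rewrite /= !degNdelta !mxE Ekk oppr0.
have dega : deg (- delta_mx 0 k) (pneg E2 k + delta_mx 0 k - ppos E k) = -1.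
  by rewrite degNdelta !mxE E2kk Ekk !eqxx.
(* Grade by minus the exponent of variable [k]: the first summand of [C] has degree -1 and [P] has
   degree 0. If [E k j = -1], then [x ^+ b] is 1, and writing [S = e + z * T] leaves one more term,
   of degree 0; otherwise [x ^+ b] already contains a factor [P]. *)
case: b => [|b] in Eb E1kj a1 R z S zL z1L SE SL CE AE Anzd expE CL *.
  pose T v := \sum_(m < e) \sum_(i < m) (1 + z v) ^+ i.
  have TL : Laur T by apply: Laur_sum => m.
  have ST v : S v = e%:R + z v * T v.
    rewrite /S /T big_distrr /= -[e in e%:R]card_ord -sumr_const -big_split /=.
    by apply: eq_bigr => m _; rewrite {1}SE.
  apply: (@nzd_extremal _ _ (- delta_mx 0 k) C P
    (fun v => D2 v * y1 v * R v * R v / v 0 k * T v) _ 0 1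
    (pneg E2 k + delta_mx 0 k - ppos E k) [:: (e%:R, pneg E2 k + expo E1 k + (a1 - nN))]
    Pn0 _ degP (oner_neq0 _)).
  - by move=> v _; rewrite /P exch_ev.
  - rewrite /= andbT dega degNdelta !mxE E2kk E1kk E1kj !eqxx.
    by [].
  - by laur.
  move=> v v0; rewrite CE // -aE // -[RHS]addrA; congr (_ + _).
  rewrite expr0 mulr1 ST mulrDr; congr (_ + _).
    rewrite /ev big_seq1 /= (monD _ (a1 - nN) v0) (monD (pneg E2 k) _ v0).
    by rewrite -/(D2 v) -/(y1 v) -/(R v); ring.
  rewrite /z expr1 xE; have := vk0 v v0 => vk; by field.
apply: (@nzd_extremal _ _ (- delta_mx 0 k) C P
    (fun v => D2 v * y1 v * R v * x v ^+ b / v 0 k * S v) _ 0 1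
    (pneg E2 k + delta_mx 0 k - ppos E k) [::] Pn0 _ degP (oner_neq0 _)) => //.
- by move=> v _; rewrite /P exch_ev.
- by have := SL e; laur.
move=> v v0; rewrite CE // -aE // /ev big_nil addr0; congr (_ + _).
rewrite exprS {1}xE; have := vk0 v v0 => vk; by field.
Qed.

End Caterpillar.

(** * The Laurent phenomenon *)

Section LaurentPhenomenon.
Variables (F : realFieldType) (N : nat).
Implicit Types (v : 'rV[F]_N) (a : 'rV[int]_N) (E : 'M[int]_N) (i j k : 'I_N).

Lemma deg_expo phi E k : deg phi (expo E k) = deg phi (ppos E k) - deg phi (pneg E k).
Proof.
rewrite /deg -sumrB; apply: eq_bigr => i _.
by rewrite !mxE -mulrBr pos_partB.
Qed.

(** Here the two mutations commute: the third variable is the original variable [k], a monomial. The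
    second one has two terms of different [phi]-degree, so one of them is extremal, while [exch E k]
    is [phi]-homogeneous. *)
Lemma caterpillar_commute E k j phi : k != j -> E k k = 0 -> E j j = 0 ->
    E k j = 0 -> E j k = 0 -> deg phi (expo E k) = 0 -> deg phi (expo E j) != 0 ->
  let E1 := mutate k E in let E2 := mutate j E1 in
  let v2 := fun v : 'rV[F]_N => mutpt j E1 (mutpt k E v) in
  let A := fun v => v2 v 0 j in let C := fun v => mutpt k E2 (v2 v) 0 k in
  [/\ Laur A, Laur C, nzd A (exch E k) & nzd C (exch E k)].
Proof.
move=> kj Ekk Ejj Ekj Ejk phik phij E1 E2 v2 A C.
have jk : j != k by rewrite eq_sym.
have E1j i : E1 i j = E i j.
  rewrite mxE (negPf jk) orbF; case: eqP => [->|_]; first by rewrite Ekj oppr0.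
  by rewrite Ekj mulr0 pos_part0 // mulr0 addr0.
have E1k i : E1 i k = - E i k by rewrite mxE eqxx orbT.
have E2k i : E2 i k = - E i k.
  rewrite mxE (negPf kj) orbF !E1k E1j; case: eqP => [->|_]; first by rewrite Ejk oppr0.
  by rewrite Ejk oppr0 mulr0 pos_part0 // mulr0 addr0.
have AE v : positive v -> A v = exch E j v / v 0 j.
  move=> v0; rewrite /A /v2 mutptk mutpt_neq // /exch.
  have h1 : ppos E1 j 0 k = 0 by rewrite mxE E1j Ekj.
  have h2 : pneg E1 j 0 k = 0 by rewrite mxE E1j Ekj.
  rewrite !mon_mutpt0 //.
  by congr ((mon v _ + mon v _) / _); apply/rowP => i; rewrite [LHS]mxE [RHS]mxE E1j.
have CE v : positive v -> C v = v 0 k.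
  move=> v0; rewrite /C mutptk /v2 mutpt_neq // mutptk.
  have -> : exch E2 k (mutpt j E1 (mutpt k E v)) = exch E k v.
    have v10 := mutpt_pos k E v0.
    have h1 x : E x k = 0 -> ppos (- E2) k 0 x = 0 by move=> Ex; rewrite mxE [(- E2) _ _]mxE E2k Ex.
    have h2 x : E x k = 0 -> pneg (- E2) k 0 x = 0 by move=> Ex; rewrite mxE [(- E2) _ _]mxE E2k Ex.
    rewrite -exchN /exch !mon_mutpt0 ?h1 ?h2 //.
    congr (mon v _ + mon v _); apply/rowP => i;
      by rewrite [LHS]mxE [RHS]mxE [(- E2) _ _]mxE E2k opprK.
  have P0 := exch_neq0 E k v0; have vk : v 0 k != 0 by rewrite gt_eqF.
  by field; rewrite vk P0.
have Pn0 v : positive v -> exch E k v != 0 by apply: exch_neq0.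
have degPk : deg phi (ppos E k) = deg phi (pneg E k).
  by apply/eqP; rewrite -subr_eq0 -deg_expo phik.
have degP : all (fun u : F * 'rV[int]_N => deg phi u.2 == deg phi (pneg E k))
    [:: (1, ppos E k); (1, pneg E k)] by rewrite /= degPk eqxx.
split.
- by apply: Laur_ext AE _; apply: LaurM (Laur_exch _ _ _) (Laur_coordV _ _).
- by apply: Laur_ext CE _; apply: Laur_coord.
- have degB a : deg phi (a - delta_mx 0 j) = deg phi a + deg phi (- delta_mx 0 j) by apply: degD.
  have split2 v : positive v -> A v =
      mon v (ppos E j - delta_mx 0 j) + mon v (pneg E j - delta_mx 0 j).
    by move=> v0; rewrite AE // /exch !monB // mon_delta mulrDl.
  have [lt|lt] : deg phi (pneg E j) < deg phi (ppos E j) \/ deg phi (ppos E j) < deg phi (pneg E j).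
    by move: phij; rewrite deg_expo subr_eq0 neq_lt => /orP[]; [right|left].
  + apply: (@nzd_extremal _ _ phi A (exch E k) (fun=> 0) _ _ 1 (pneg E j - delta_mx 0 j)
      [:: (1, ppos E j - delta_mx 0 j)] Pn0 _ degP (oner_neq0 _)).
    * by move=> v _; rewrite exch_ev.
    * by rewrite /= andbT !degB ltrD2r.
    * exact: Laur_const.
    * by move=> v v0; rewrite split2 // /ev big_seq1 /= !mul1r mulr0 addr0 addrC.
  + apply: (@nzd_extremal _ _ phi A (exch E k) (fun=> 0) _ _ 1 (ppos E j - delta_mx 0 j)
      [:: (1, pneg E j - delta_mx 0 j)] Pn0 _ degP (oner_neq0 _)).
    * by move=> v _; rewrite exch_ev.
    * by rewrite /= andbT !degB ltrD2r.
    * exact: Laur_const.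
    * by move=> v v0; rewrite split2 // /ev big_seq1 /= !mul1r mulr0 addr0.
- apply: (@nzd_extremal _ _ phi C (exch E k) (fun=> 0) _ _ 1 (delta_mx 0 k)
      [::] Pn0 _ degP (oner_neq0 _)) => //.
  + by move=> v _; rewrite exch_ev.
  + exact: Laur_const.
  + by move=> v v0; rewrite CE // mon_delta /ev big_nil mul1r mulr0 !addr0.
Qed.

Lemma caterpillar E k j phi : k != j -> E k k = 0 -> E j j = 0 ->
    E k j * E j k <= 0 -> (E k j * E j k = 0 -> E k j = 0 /\ E j k = 0) ->
    deg phi (expo E k) = 0 -> deg phi (expo E j) != 0 ->
  let E1 := mutate k E in let E2 := mutate j E1 in
  let v2 := fun v : 'rV[F]_N => mutpt j E1 (mutpt k E v) in
  let A := fun v => v2 v 0 j in let C := fun v => mutpt k E2 (v2 v) 0 k in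
  [/\ Laur A, Laur C, nzd A (exch E k) & nzd C (exch E k)].
Proof.
move=> kj Ekk Ejj sgn sgn0 phik phij.
case: (ltrgt0P (E k j)) => Ekj.
- have Ejk : E j k < 0.
    rewrite lt_neqAle -(pmulr_rle0 _ Ekj) sgn andbT; apply/eqP => Ejk.
    by move: Ekj; rewrite (sgn0 _).1 ?ltxx // Ejk mulr0.
  (* Negating [E] swaps the two terms of every exchange relation and so changes no cluster
     variable. *)
  have := @caterpillar_pos F N (- E) k j kj; rewrite !mxE Ekk Ejj oppr0.
  rewrite oppr_lt0 oppr_gt0 => /(_ erefl erefl Ekj Ejk) /= [].
  move=> AL CL AN CN; split.
  + by apply: Laur_ext AL => v _; rewrite mutateN !mutptN.
  + by apply: Laur_ext CL => v _; rewrite !mutateN !mutptN.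
  + move=> w wL Aw; apply: Laur_ext (AN w wL _) => [v _|]; first by rewrite exchN.
    by apply: Laur_ext Aw => v _; rewrite !mutateN !mutptN exchN.
  + move=> w wL Aw; apply: Laur_ext (CN w wL _) => [v _|]; first by rewrite exchN.
    by apply: Laur_ext Aw => v _; rewrite !mutateN !mutptN exchN.
- have Ejk : 0 < E j k.
    rewrite lt_neqAle -(nmulr_rle0 _ Ekj) sgn andbT eq_sym; apply/eqP => Ejk.
    by move: Ekj; rewrite (sgn0 _).1 ?ltxx // Ejk mulr0.
  exact: caterpillar_pos.
- have [_ Ejk] := sgn0 (etrans (congr1 (fun x => x * _) Ekj) (mul0r _)).
  exact: caterpillar_commute phij.
Qed.

(* The mutable indices. *)
Variable D : pred 'I_N.

(** The second clause makes any two distinct mutable columns linearly independent; it stands in for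
    coprimality of the exchange polynomials. *)
Definition admissible E :=
  (forall i j, D i -> D j -> E i j * E j i <= 0 /\ (E i j * E j i = 0 -> E i j = 0 /\ E j i = 0))
  /\ (forall j k, D j -> D k -> j != k ->
        exists phi, deg phi (expo E k) = 0 /\ deg phi (expo E j) != 0).

Definition totally_admissible E := forall w, all D w -> admissible (mutate_seq E w).

Lemma admissible_diag E k : admissible E -> D k -> E k k = 0.
Proof.
move=> [sE _] Dk; have [le0 eq0] := sE k k Dk Dk.
by case: eq0 => //; apply/eqP; rewrite eq_le le0 -expr2 sqr_ge0.
Qed.

Fixpoint walk E v (w : seq 'I_N) : 'rV[F]_N :=
  if w is k :: w' then walk (mutate k E) (mutpt k E v) w' else v.

(** Induction on the length, for a walk starting with [k], [j]. Expanded in the cluster after [k],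
    the final variable has only powers of [P] as denominators. Expanded in the cluster after [k],
    [j], [k], from which one step [k] back and the rest of the walk are shorter than the whole, it
    has only powers of [A * C]. As [A * C] is not a zero divisor modulo [P], [Laur_clear] removes
    both. *)
Theorem laurent E w i : totally_admissible E -> all D w ->
  Laur (fun v => walk E v w 0 i).
Proof.
elim: {w}(size w) {-2}w (leqnn (size w)) E i => [|m IHm] w.
  by rewrite leqn0 size_eq0 => /eqP-> E i _ _; apply: Laur_coord.
case: w => [|k [|j w]] wm E i tE Dw.
- exact: Laur_coord.
- case: (eqVneq i k) => [->|ik].
    by apply: (Laur_ext (fun v _ => mutptk k E v));
       apply: LaurM (Laur_exch _ _ _) (Laur_coordV _ _).
  by apply: (Laur_ext (fun v _ => mutpt_neq E v ik)); apply: Laur_coord.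
move: Dw wm => /= /and3P[Dk Dj Dw] wm.
have aE : admissible E by apply: (tE [::]).
have Ekk := admissible_diag aE Dk; have Ejj := admissible_diag aE Dj.
have tE1 x E' : D x -> totally_admissible E' -> totally_admissible (mutate x E').
  by move=> Dx tE' u Du; apply: (tE' (x :: u)); rewrite /= Dx.
case: (eqVneq k j) => [kj|kj].
  rewrite -kj; apply: (Laur_ext (g := fun v => walk E v w 0 i)); last first.
    by apply: IHm => //; lia.
  by move=> v v0; rewrite mutateK mutptK.
pose E1 := mutate k E; pose E2 := mutate j E1.
have [phi [phik phij]] := aE.2 j k Dj Dk (contra_neq esym kj).
have [sgn sgn0] := aE.1 k j Dk Dj.
have [AL CL AN CN] := caterpillar kj Ekk Ejj sgn sgn0 phik phij.
set v2 := fun v : 'rV[F]_N => mutpt j E1 (mutpt k E v) in AL CL AN CN.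
set A := fun v => v2 v 0 j in AL AN; set C := fun v => mutpt k E2 (v2 v) 0 k in CL CN.
set z := fun v => _; pose P := exch (F := F) E k.
have Pn0 v : positive v -> P v != 0 by apply: exch_neq0.
have PL : Laur P by apply: Laur_exch.
have v2pos v : positive v -> positive (v2 v) by move=> v0; do 2!apply: mutpt_pos.
have [p zP] : exists p, Laur (fun v => z v * P v ^+ p).
  apply: (Laur_comp (f := fun u => walk E1 u (j :: w) 0 i) (g := mutpt k E)) => //.
  - apply: IHm => //=; [exact: tE1 | by rewrite Dj].
  - exact: mutpt_pos.
  - move=> x; case: (eqVneq x k) => [->|xk].
      by apply: (Laur_ext (fun v _ => mutptk k E v)); apply: LaurM PL (Laur_coordV _ _).
    by apply: (Laur_ext (fun v _ => mutpt_neq E v xk)); apply: Laur_coord.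
  - move=> x; case: (eqVneq x k) => [->|xk].
      apply: Laur_ext (Laur_coord _ k) => v v0; rewrite mutptk -/(P v).
      by have vk : v 0 k != 0 by [rewrite gt_eqF]; have := Pn0 v v0 => P0; field; rewrite vk P0.
    by apply: (Laur_ext (g := fun v => P v * (v 0 x)^-1)) => [v _|]; rewrite ?mutpt_neq //; laur.
have [q zQ] : exists q, Laur (fun v => z v * (A v * C v) ^+ q).
  have [q zQ] : exists q, Laur (fun v => walk (mutate k E2) (mutpt k E2 (v2 v)) (k :: w) 0 i
                                    * (A v * C v) ^+ q).
    apply: (Laur_comp (f := fun u => walk (mutate k E2) u (k :: w) 0 i)
                      (g := fun v => mutpt k E2 (v2 v))).
    - by apply: IHm => //=; [do 3!apply: (tE1) => // | rewrite Dk].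
    - by move=> v v0; apply: mutpt_pos; apply: v2pos.
    - move=> x; case: (eqVneq x k) => [-> //|xk].
      apply: (Laur_ext (g := fun v => v2 v 0 x)) => [v _|]; first by rewrite mutpt_neq.
      case: (eqVneq x j) => [-> //|xj].
      apply: (Laur_ext (g := fun v => v 0 x)) => [v _|]; first by rewrite /v2 !mutpt_neq.
      exact: Laur_coord.
    - exact: LaurM.
    - move=> x; case: (eqVneq x k) => [->|xk].
        apply: Laur_ext AL => v v0; rewrite -/(C v) mulfK // gt_eqF //.
        by apply: mutpt_pos; apply: v2pos.
      case: (eqVneq x j) => [->|xj].
        apply: Laur_ext CL => v v0; rewrite mutpt_neq 1?eq_sym // -/(A v) mulrC mulKf //.
        by rewrite gt_eqF //; apply: v2pos.
      apply: (Laur_ext (g := fun v => A v * C v * (v 0 x)^-1)) => [v _|]; last by laur.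
      by rewrite /v2 !mutpt_neq.
  exists q; apply: Laur_ext zQ => v v0; congr (_ * _).
  rewrite /= mutateK mutptK //; first exact: v2pos.
  by apply: (@admissible_diag E2) => //; apply: (tE [:: k; j]); rewrite /= Dk Dj.
apply: (Laur_clear Pn0 (LaurM AL CL) PL (nzdM CL AN CN) zP zQ).
Qed.

End LaurentPhenomenon.

(** * Mutation as multiplication by elementary matrices *)

Section ElementaryMatrices.
Variable n : nat.
Implicit Types (A M C G X Y : 'M[int]_n) (k l i j : 'I_n) (e : int).

(** For suitable signs [e] these are the factors that a mutation multiplies onto C and G on the
    right, and a move of the initial vertex on the left. *)
Definition row_el k e M : 'M[int]_n := J_mx k + only_row k (pos_mx (e *: M)).
Definition col_el k e M : 'M[int]_n := J_mx k + only_col k (pos_mx (e *: M)).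

Lemma only_rowT k A : (only_row k A)^T = only_col k A^T.
Proof. by apply/matrixP => i j; rewrite !mxE. Qed.

Lemma pos_mxT A : (pos_mx A)^T = pos_mx A^T.
Proof. by apply/matrixP => i j; rewrite !mxE. Qed.

Lemma row_elT k e M : (row_el k e M)^T = col_el k e M^T.
Proof.
by rewrite /row_el /col_el linearD /= tr_diag_mx only_rowT pos_mxT linearZ.
Qed.

Lemma col_elT k e M : (col_el k e M)^T = row_el k e M^T.
Proof. by rewrite -[M in LHS]trmxK -row_elT trmxK. Qed.

Lemma mulJ k A i j : (J_mx k *m A) i j = if i == k then - A i j else A i j.
Proof. by rewrite /J_mx mul_diag_mx !mxE; case: eqP => _; rewrite ?mulN1r ?mul1r. Qed.

Lemma mul_only_row k X A i j :
  (only_row k X *m A) i j = if i == k then (X *m A) i j else 0.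
Proof.
rewrite !mxE; case: eqP => ik; last by apply: big1 => l _; rewrite !mxE (introF eqP ik) mul0r.
by apply: eq_bigr => l _; rewrite !mxE ik eqxx.
Qed.

Lemma mul_only_col k X A i j : (only_col k X *m A) i j = X i k * A k j.
Proof.
rewrite !mxE (bigD1 k) //= big1 => [|l /negPf lk]; last by rewrite !mxE lk mul0r.
by rewrite !mxE eqxx addr0.
Qed.

Lemma mul_row_el k e M A i j : (row_el k e M *m A) i j =
  if i == k then - A k j + \sum_l pos_part (e * M k l) * A l j else A i j.
Proof.
rewrite mulmxDl mxE mulJ mul_only_row; case: eqP => [->|_]; last by rewrite addr0.
by congr (_ + _); rewrite mxE; apply: eq_bigr => l _; rewrite !mxE.
Qed.

Lemma mul_col_el k e M A i j : (col_el k e M *m A) i j =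
  (if i == k then - A k j else A i j) + pos_part (e * M i k) * A k j.
Proof. by rewrite mulmxDl mxE mulJ mul_only_col !mxE; case: eqP => [->|]. Qed.

Lemma mulr_col_el k e M A i j : (A *m col_el k e M) i j =
  if j == k then - A i k + \sum_l A i l * pos_part (e * M l k) else A i j.
Proof.
have -> : A *m col_el k e M = (row_el k e M^T *m A^T)^T.
  by rewrite trmx_mul row_elT !trmxK.
rewrite mxE mul_row_el; case: eqP => _; last by rewrite mxE.
by rewrite mxE; congr (_ + _); apply: eq_bigr => l _; rewrite !mxE mulrC.
Qed.

Lemma mulr_row_el k e M A i j : (A *m row_el k e M) i j =
  (if j == k then - A i k else A i j) + A i k * pos_part (e * M k j).
Proof.
have -> : A *m row_el k e M = (col_el k e M^T *m A^T)^T.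
  by rewrite trmx_mul col_elT !trmxK.
by rewrite mxE mul_col_el !mxE mulrC.
Qed.

Lemma row_elE k e M i j : row_el k e M i j =
  if i == k then - (k == j)%:R + pos_part (e * M k j) else (i == j)%:R.
Proof.
rewrite -[row_el _ _ _]mulmx1 mul_row_el; case: eqP => [_|_]; rewrite !mxE //.
congr (_ + _); rewrite (bigD1 j) //= big1 => [|l lj]; last by rewrite mxE (negPf lj) mulr0.
by rewrite mxE eqxx mulr1 addr0.
Qed.

Lemma row_elK k e M : M k k = 0 -> row_el k e M *m row_el k e M = 1%:M.
Proof.
move=> Mk; apply/matrixP => i j; rewrite mulr_row_el.
rewrite !row_elE !mxE eqxx Mk mulr0 // addr0.
case: (eqVneq i k) => [->|ik]; case: (eqVneq j k) => [->|jk]; rewrite ?eqxx ?Mk ?mulr0 //=.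
  by rewrite oppr0 add0r mulN1r subrr.
  by rewrite (negPf ik) oppr0 addr0.
by rewrite mul0r addr0.
Qed.

Lemma col_elK k e M : M k k = 0 -> col_el k e M *m col_el k e M = 1%:M.
Proof.
move=> Mk; apply: trmx_inj; rewrite trmx_mul !col_elT trmx1.
by rewrite row_elK // mxE.
Qed.

(** The correction term of a mutation can be written with either sign [e]; this freedom lets [e] be
    adapted to the sign of a column of C. *)
Lemma pos_part_mutate (a b e : int) : e = 1 \/ e = -1 ->
  a * pos_part (e * b) + pos_part (- e * a) * b = Num.sg a * pos_part (a * b).
Proof.
have pN x : pos_part x = x + pos_part (- x) by have := pos_partB x; lia.
have H x y : x * pos_part y + pos_part (- x) * y = Num.sg x * pos_part (x * y).
  case: (ltrgt0P x) => x0.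
  - rewrite gtr0_sg // [pos_part (- x)]pos_part0 ?oppr_le0 ?ltW // mul0r addr0 mul1r.
    case: (lerP 0 y) => y0; first by rewrite !pos_part_id // pmulr_rge0.
    by rewrite !pos_part0 ?mulr0 ?ltW // pmulr_rlt0.
  - rewrite ltr0_sg // [pos_part (- x)]pos_part_id ?oppr_ge0 ?ltW // mulN1r.
    case: (lerP 0 y) => y0.
      by rewrite [pos_part y]pos_part_id // pos_part0 ?nmulr_rle0 //; ring.
    by rewrite [pos_part y]pos_part0 ?ltW // pos_part_id ?nmulr_rge0 ?ltW //; ring.
  - by rewrite x0 sgr0 !mul0r.
case=> ->; rewrite ?mul1r ?mulN1r ?opprK //.
by rewrite -(H a b) (pN b) (pN a); ring.
Qed.

Lemma mutate_el k e M : M k k = 0 -> e = 1 \/ e = -1 ->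
  mutate k M = col_el k (- e) M *m M *m row_el k e M.
Proof.
move=> Mk he; apply/matrixP => i j.
rewrite mulr_row_el !mul_col_el !mxE Mk !mulr0 !addr0 !oppr0.
case: (eqVneq i k) => [->|ik] /=.
  rewrite Mk mulr0 // mul0r oppr0 addr0.
  by case: (eqVneq j k) => [->|]; rewrite ?Mk ?oppr0 // !mul0r ?addr0.
case: (eqVneq j k) => [->|jk] /=.
  by rewrite Mk mulr0 // mulr0 addr0.
by rewrite -(pos_part_mutate _ _ he) addrAC addrA.
Qed.

Lemma C_stepE k M C i j : M k k = 0 -> C_step k M C i j =
  if j == k then - C i k else C i j + Num.sg (C i k) * pos_part (C i k * M k j).
Proof.
move=> Mk; rewrite /C_step -[M in pos_mx M]scale1r -/(row_el k 1 M) mxE mulr_row_el.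
rewrite mul_only_col !mxE; case: eqP => [->|_].
  by rewrite Mk mulr0 // !mulr0 !addr0.
by rewrite -(pos_part_mutate _ _ (or_introl erefl)) !mul1r mulN1r addrA.
Qed.

Lemma C_step_sign k M C e : M k k = 0 -> e = 1 \/ e = -1 ->
  (forall i, 0 <= e * C i k) -> C_step k M C = C *m row_el k e M.
Proof.
move=> Mk he Ck; apply/matrixP => i j; rewrite C_stepE // mulr_row_el.
case: eqP => [->|_]; first by rewrite Mk mulr0 // mulr0 addr0.
rewrite -(pos_part_mutate _ _ he) [pos_part (- e * _)]pos_part0 ?mul0r ?addr0 //.
by rewrite mulNr oppr_le0.
Qed.

(** For [e = 1] the term with [M0] vanishes. For [e = -1] it is minus column [k] of [M0 *m C], that
    is of [G *m M], and subtracting it turns the positive part of [- M] into that of [M]. *)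
Lemma G_step_sign k M0 M C G e : e = 1 \/ e = -1 ->
  (forall i, 0 <= e * C i k) -> G *m M = M0 *m C ->
  G_step k M0 M C G = G *m col_el k (- e) M.
Proof.
move=> he Ck GM; apply/matrixP => i j; rewrite /G_step -scaleN1r -/(col_el k (-1) M).
rewrite mxE [X in _ + X]mxE !mulr_col_el.
have -> : (M0 *m only_col k (pos_mx (- C))) i j =
    if j == k then \sum_l M0 i l * pos_part (- C l k) else 0.
  rewrite mxE; case: eqP => [->|/eqP/negPf jk].
    by apply: eq_bigr => l _; rewrite !mxE eqxx.
  by apply: big1 => l _; rewrite !mxE jk mulr0.
case: eqP => _; last by rewrite subr0.
case: he Ck => -> Ck.
  rewrite [X in _ - X]big1 ?subr0 // => l _.
  by have := Ck l; rewrite mul1r => Cl; rewrite pos_part0 ?oppr_le0 ?mulr0.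
have -> : \sum_l M0 i l * pos_part (- C l k) = - \sum_l G i l * M l k.
  have := congr1 (fun X : 'M_n => X i k) GM; rewrite !mxE => ->.
  rewrite -sumrN; apply: eq_bigr => l _; rewrite pos_part_id ?mulrN //.
  by have := Ck l; rewrite mulN1r.
rewrite opprK -addrA; congr (_ + _); rewrite -big_split /=; apply: eq_bigr => l _.
by rewrite opprK mul1r mulN1r -mulrDr -[X in _ * (_ + X) = _]pos_partB [X in _ * X = _]addrC subrK.
Qed.

(** The correction term is nonzero only if both factors have the same sign, so either sign may be
    used. *)
Lemma mutate_tr k M : mutate k M^T = (mutate k M)^T.
Proof.
apply/matrixP => i j; rewrite !mxE orbC; case: ifP => // _; congr (_ + _).
rewrite [M k i * _]mulrC; case: (ltrP 0 (M j k * M k i)) => [|le0]; last first.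
  by rewrite pos_part0 // !mulr0.
rewrite -sgr_gt0 sgrM; case: sgrP => // _; case: sgrP => // _;
  by rewrite ?mulN1r ?mul1r ?mulr0 // ltr0N1.
Qed.

End ElementaryMatrices.

(** * Degeneration of the cluster variables *)

Section LeadingTerms.
Variable F : realFieldType.
Implicit Types (u : 'rV[F]_2) (s t : seq (F * 'rV[int]_2)) (f g p q : 'rV[F]_2 -> F).

Let phi : 'rV[int]_2 := delta_mx 0 1.

Lemma deg_phi a : deg phi a = a 0 1.
Proof.
rewrite /deg (bigD1 1) //= big1 ?addr0 => [|i /negPf i1]; last by rewrite mxE i1 andbF mul0r.
by rewrite mxE !eqxx mul1r.
Qed.

(* f is a Laurent polynomial in u 0 0 and an honest polynomial in u 0 1, and p
   is its value at u 0 1 = 0. *)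
Definition lead f p := exists s,
  [/\ all (fun e => 0 <= deg phi e.2) s, forall u, positive u -> f u = ev s u
    & forall u, positive u -> ev (part phi 0 s) u = p u].

Lemma lead_ext f g p q : (forall u, positive u -> f u = g u) ->
  (forall u, positive u -> p u = q u) -> lead g q -> lead f p.
Proof.
move=> fg pq [s [s0 gs qs]]; exists s; split=> // u u0; first by rewrite fg ?gs.
by rewrite qs ?pq.
Qed.

Lemma leadD f g p q : lead f p -> lead g q -> lead (fun u => f u + g u) (fun u => p u + q u).
Proof.
move=> [s [s0 fs ps]] [t [t0 gt qt]]; exists (s ++ t); split=> [|u u0|u u0].
- by rewrite all_cat s0.
- by rewrite ev_cat fs ?gt.
- by rewrite /part filter_cat ev_cat -/(part _ _ s) -/(part _ _ t) ps ?qt.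
Qed.

Lemma part_mulL d s t : all (fun e => 0 <= deg phi e.2) s ->
    all (fun e => d <= deg phi e.2) t ->
  part phi d (mulL s t) = mulL (part phi 0 s) (part phi d t).
Proof.
move=> s0 td; rewrite /mulL /part.
elim: s s0 => //= x s IHs /andP[x0 s0]; rewrite filter_cat IHs // filter_map.
case: ifP => [/eqP x00|x00] /=.
  congr (map _ _ ++ _); apply: eq_filter => y /=; by rewrite degD x00 add0r.
rewrite [X in map _ X](_ : _ = [::]) //; apply/eqP.
rewrite -[_ == _]negbK -has_filter; apply/hasPn => y yt /=.
have yd := allP td y yt; rewrite degD; apply: contraFN x00 => /eqP xy.
by rewrite eq_le x0 andbT -(lerD2r (deg phi y.2)) xy add0r.
Qed.

Lemma leadM f g p q : lead f p -> lead g q -> lead (fun u => f u * g u) (fun u => p u * q u).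
Proof.
move=> [s [s0 fs ps]] [t [t0 gt qt]]; exists (mulL s t); split=> [|u u0|u u0].
- apply/allP => z /allpairsP[[x y] /= [xs yt ->]] /=.
  by rewrite degD; apply: addr_ge0; [exact: (allP s0 x) | exact: (allP t0 y)].
- by rewrite ev_mul // fs ?gt.
- by rewrite part_mulL // ev_mul // ps ?qt.
Qed.

Lemma lead_const c : lead (fun=> c) (fun=> c).
Proof.
exists [:: (c, 0)]; split=> [|u u0|u u0].
- by rewrite /= deg_phi mxE.
- by rewrite /ev big_seq1 mon0 mulr1.
- by rewrite /part /= deg_phi mxE eqxx /ev big_seq1 mon0 mulr1.
Qed.

Lemma lead_y : lead (fun u => u 0 0) (fun u => u 0 0).
Proof.
exists [:: (1, delta_mx 0 0)]; split=> [|u u0|u u0].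
- by rewrite /= deg_phi mxE.
- by rewrite /ev big_seq1 mon_delta mul1r.
- by rewrite /part /= deg_phi mxE /= /ev big_seq1 mon_delta mul1r.
Qed.

Lemma lead_eps : lead (fun u => u 0 1) (fun=> 0).
Proof.
exists [:: (1, delta_mx 0 1)]; split=> [|u u0|u u0].
- by rewrite /= deg_phi mxE.
- by rewrite /ev big_seq1 mon_delta mul1r.
- by rewrite /part /= deg_phi mxE /= /ev big_nil.
Qed.

Lemma leadX f p m : lead f p -> lead (fun u => f u ^+ m) (fun u => p u ^+ m).
Proof.
move=> fp; elim: m => [|m IHm]; first exact: lead_const.
by apply: lead_ext (leadM fp IHm) => u _; rewrite exprS.
Qed.

Lemma lead_prod (I : Type) (r : seq I) (fs ps : I -> 'rV[F]_2 -> F) :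
  (forall i, lead (fs i) (ps i)) ->
  lead (fun u => \prod_(i <- r) fs i u) (fun u => \prod_(i <- r) ps i u).
Proof.
move=> fL; elim: r => [|i r IHr].
  by apply: lead_ext (lead_const 1) => u _; rewrite big_nil.
by apply: lead_ext (leadM (fL i) IHr) => u _; rewrite big_cons.
Qed.

(** A lowest part of [g] of negative degree, multiplied by [p], would be a part of [f * g] of
    negative degree. It therefore vanishes as a function and its terms can be discarded; this is
    repeated until no negative degree is left. *)
Lemma lead_div f g p q : lead f p -> (forall u, positive u -> p u != 0) ->
  lead (fun u => f u * g u) q -> Laur g -> lead g (fun u => q u / p u).
Proof.
move=> [s [s0 fs ps]] pn0 [r [r0 fgr qr]] [t0 gt0].
have prodE t : (forall u, positive u -> g u = ev t u) ->
    forall u, positive u -> ev (mulL s t) u = ev r u.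
  by move=> gt u u0; rewrite ev_mul // -fs // -gt // fgr.
have nonneg t : (forall u, positive u -> g u = ev t u) ->
    all (fun e => 0 <= deg phi e.2) t -> lead g (fun u => q u / p u).
  move=> gt tge0; exists t; split=> // u u0; apply: (canRL (mulfK (pn0 u u0))).
  rewrite mulrC -ps // -qr // -ev_mul // -part_mulL //.
  by apply: ev_part_eq => // v v0; apply: prodE.
elim: {t0}(size t0) {-2}t0 (leqnn (size t0)) gt0 => [|m IHm] t tm gt.
  by apply: (nonneg t) => //; move: tm; rewrite leqn0 size_eq0 => /eqP->.
case: (boolP (all (fun e => 0 <= deg phi e.2) t)) => [|tn0]; first exact: nonneg.
have tne : t != [::] by apply: contraNneq tn0 => ->.
have [x xt xmin] := min_deg phi tne.
have xlt0 : deg phi x.2 < 0.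
  move: tn0; rewrite -has_predC => /hasP[y yt /=]; rewrite -ltNge; apply: le_lt_trans.
  exact: (allP xmin).
have lo0 u : positive u -> ev (part phi (deg phi x.2) t) u = 0.
  move=> u0; apply: (mulfI (pn0 u u0)); rewrite mulr0 -ps // -ev_mul // -part_mulL //.
  rewrite (ev_part_eq _ _ (prodE t gt)) // /part.
  rewrite [X in ev X](_ : _ = [::]) ?[ev [::] _]big_nil //.
  apply/eqP; rewrite -[_ == _]negbK -has_filter; apply/hasPn => y yr /=.
  by rewrite gt_eqF // (lt_le_trans xlt0) // (allP r0).
apply: (IHm [seq e <- t | deg phi e.2 != deg phi x.2]).
  rewrite -ltnS; apply: leq_trans tm; rewrite size_filter.
  rewrite -(count_predC (fun e => deg phi e.2 != deg phi x.2) t).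
  by rewrite -[ltnLHS]addn0 ltn_add2l -has_count; apply/hasP; exists x => //=; rewrite negbK.
move=> u u0; rewrite gt // -[RHS]add0r -(lo0 u) // /ev /part !big_filter.
by rewrite (bigID (fun e => deg phi e.2 == deg phi x.2)).
Qed.

(** If [h] were negative, clearing powers of [y] would give a polynomial identity
    [r * (1 + 'X) ^+ m.+1 = 'X^K], which fails at -1. *)
Lemma lead_ge0 f (h : int) : lead f (fun u => (1 + u 0 0) ^ h) -> 0 <= h.
Proof.
case: h => // m [s [_ _ sE]]; exfalso.
set t := part phi 0 s in sE.
pose K : nat := (\sum_(e <- t) `|e.2 0%R 0%R|)%N.
have Kt e : e \in t -> 0 <= e.2 0 0 + K%:Z.
  move=> et; suff: (`|e.2 0%R 0%R| <= K)%N by lia.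
  by rewrite /K (big_rem e) //= leq_addr.
pose r : {poly F} := \sum_(e <- t) e.1 *: 'X^(absz (e.2 0 0 + K%:Z)).
have req : r * (1 + 'X) ^+ m.+1 - 'X^K = 0.
  apply: poly_pos_eq0 => tau t0; have tn0 : tau != 0 by rewrite gt_eqF.
  pose u : 'rV[F]_2 := \row_i (if i == 0 then tau else 1).
  have u0 : positive u by move=> i; rewrite mxE; case: ifP.
  have := sE u u0; rewrite NegzE -exprnN mxE eqxx => tE.
  have n0 : (1 + tau) ^+ m.+1 != 0 by rewrite expf_neq0 // gt_eqF // addr_gt0.
  rewrite hornerD hornerN hornerM horner_exp hornerD hornerX hornerXn hornerC.
  have -> : r.[tau] = tau ^+ K * ev t u.
    rewrite /r horner_sum /ev big_distrr /=; apply: eq_big_seq => e et.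
    rewrite hornerZ hornerXn exprnP gez0_abs ?Kt // expfzDr //.
    rewrite /mon big_ord_recl big_ord1 !mxE /= exp1rz mulr1 -exprnP; ring.
  by rewrite tE mulfVK ?subrr.
have := congr1 (fun P : {poly F} => P.[-1]) req.
rewrite hornerD hornerN hornerM horner_exp hornerD hornerX hornerXn hornerC horner0 subrr.
rewrite expr0n /= mulr0 sub0r => /eqP; rewrite oppr_eq0 expf_eq0 oppr_eq0 oner_eq0 andbF //.
Qed.

End LeadingTerms.

(** * Extended exchange matrices along words *)

Section Words.
Variable n : nat.
Implicit Types (B M C : 'M[int]_n) (p : seq 'I_n) (k l i j : 'I_n).

(* Words list the label of the last step first, as in CG_along. *)
Definition Bw B p : 'M[int]_n := foldr (@mutate n) B p.

Fixpoint CGw B p : 'M[int]_n * 'M[int]_n :=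
  if p is k :: p' then
    (C_step k (Bw B p') (CGw B p').1, G_step k B (Bw B p') (CGw B p').1 (CGw B p').2)
  else (1%:M, 1%:M).

Definition Cw B p := (CGw B p).1.
Definition Gw B p := (CGw B p).2.

Lemma mutate_seq_rev B p : mutate_seq B (rev p) = Bw B p.
Proof. by rewrite /mutate_seq foldl_rev. Qed.

Lemma Bw_tsss B p : totally_sign_skew_symmetric B -> totally_sign_skew_symmetric (Bw B p).
Proof.
move=> tB s; rewrite -mutate_seq_rev /mutate_seq -foldl_cat; exact: (tB (rev p ++ s)).
Qed.

Lemma tsss_diag B k : totally_sign_skew_symmetric B -> B k k = 0.
Proof.
move=> /(_ [::] k k) /= [le0 eq0]; apply: (eq0 _).1.
by apply/eqP; rewrite eq_le le0 -expr2 sqr_ge0.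
Qed.

(** The extended exchange matrix with coefficient rows [C] below [B], padded by zero columns so that
    mutation of square matrices applies. *)
Definition frame B C : 'M[int]_(n + n) := block_mx B 0 C 0.

Lemma mutate_frame k B C : B k k = 0 ->
  mutate (lshift n k) (frame B C) = frame (mutate k B) (C_step k B C).
Proof.
move=> Bk; apply/matrixP => i j; rewrite [LHS]mxE.
case: (split_ordP i) => i' ->; case: (split_ordP j) => j' ->;
  rewrite ?block_mxEul ?block_mxEur ?block_mxEdl ?block_mxEdr ?eq_lshift ?eq_rlshift /=.
- by rewrite mxE.
- by rewrite !mxE mulr0 pos_part0 // mulr0 addr0 oppr0; case: ifP.
- by rewrite C_stepE //; case: eqP => [->|].
- by rewrite !mxE mulr0 pos_part0 // mulr0 addr0.
Qed.

Definition mutable (i : 'I_(n + n)) : bool := (i < n)%N.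

Lemma mutableP (i : 'I_(n + n)) : reflect (exists k, i = lshift n k) (mutable i).
Proof.
apply: (iffP idP) => [|[k ->]]; last by rewrite /mutable /= ltn_ord.
by move=> i_n; exists (Ordinal i_n); apply: val_inj.
Qed.

(** Row [j] of the left inverse [Psi] is a linear form that is 1 on column [j] and 0 on the other
    mutable columns. A mutation multiplies the extended matrix by invertible matrices on both sides,
    so a left inverse persists. *)
Lemma framed_admissible B C (Psi : 'M[int]_(n, n + n)) w :
    totally_sign_skew_symmetric B -> Psi *m col_mx B C = 1%:M -> all mutable w ->
  admissible mutable (mutate_seq (frame B C) w).
Proof.
elim: w B C Psi => [|i w IHw] B C Psi tB PsiE /=.
  move=> _; split=> [i j /mutableP[i' ->] /mutableP[j' ->]|].
    by rewrite !block_mxEul; apply: (tB [::]).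
  move=> j k /mutableP[j' ->] /mutableP[k' ->]; rewrite eq_lshift => jk.
  have degE l : deg (row j' Psi) (expo (frame B C) (lshift n l)) = (j' == l)%:R.
    have := congr1 (fun A : 'M_n => A j' l) PsiE; rewrite !mxE => <-.
    apply: eq_bigr => i _; rewrite !mxE; congr (_ * _).
    by case: splitP => i' _; rewrite mxE; case: splitP => [l' /= /val_inj -> //|l' /= ll];
      have := ltn_ord l; rewrite ll ltnNge leq_addr.
  by exists (row j' Psi); rewrite !degE (negPf jk) eqxx.
case/andP=> /mutableP[k ->] Dw; have Bk := tsss_diag k tB.
rewrite mutate_frame //.
pose R := row_el k 1 B; pose K := col_el k (-1) B; pose X := only_col k (pos_mx (- C)).
apply: (IHw _ _ (R *m Psi *m block_mx K 0 (- (X *m K)) 1%:M)) => //.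
  exact: (Bw_tsss [:: k] tB).
have -> : col_mx (mutate k B) (C_step k B C) = block_mx K 0 X 1%:M *m col_mx B C *m R.
  rewrite mul_block_col mul_col_mx mul0mx addr0 mul1mx; congr col_mx.
    by apply: mutate_el => //; left.
  have XE x y : (X *m B + C) x y = pos_part (- C x k) * B k y + C x y.
    by rewrite mxE mul_only_col !mxE.
  apply/matrixP => x y; rewrite C_stepE // mulr_row_el !XE Bk mulr0 add0r mul1r.
  case: eqP => [->|_]; first by rewrite Bk pos_part0 // mulr0 addr0.
  by rewrite -(pos_part_mutate _ _ (or_introl erefl)) mul1r mulN1r; ring.
rewrite !mulmxA -[R *m Psi *m _ *m _]mulmxA mulmx_block.
rewrite col_elK // !mul0mx !mulmx0 addr0 add0r !mul1mx.
have KK : K *m K = 1%:M by apply: col_elK.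
rewrite mulNmx -[X *m K *m K]mulmxA KK mulmx1 addNr add0r -scalar_mx_block mulmx1.
by rewrite -[R *m Psi *m _]mulmxA PsiE mulmx1 row_elK.
Qed.

Lemma principal_totally_admissible B :
  totally_sign_skew_symmetric B -> totally_admissible mutable (frame B 1%:M).
Proof.
move=> tB w; apply: (framed_admissible (Psi := row_mx 0 1%:M)) => //.
by rewrite mul_row_col mul0mx add0r mul1mx.
Qed.

Lemma mutate_seq_frame B p : totally_sign_skew_symmetric B ->
  mutate_seq (frame B 1%:M) (map (lshift n) (rev p)) = frame (Bw B p) (Cw B p).
Proof.
move=> tB; rewrite map_rev /mutate_seq foldl_rev; elim: p => //= k p ->.
by rewrite mutate_frame // tsss_diag //; apply: Bw_tsss.
Qed.

End Words.

(** * Limits of cluster variables with principal coefficients *)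

Section Degeneration.
Variables (F : realFieldType) (n : nat).
Implicit Types (B M C : 'M[int]_n) (p : seq 'I_n) (k l i j : 'I_n) (u : 'rV[F]_2).
Implicit Types (h : 'I_n -> int) (b : bool).

(* Principal coefficients with y_k = u 0 0 and every other y_m = u 0 1. *)
Definition base_pt k u : 'rV[F]_(n + n) :=
  row_mx (const_mx 1) (\row_m (if m == k then u 0 0 else u 0 1)).

(* The initial cluster is set to 1 at t0 or, if b, at its neighbour in direction k. *)
Definition start_pt b B k u : 'rV[F]_(n + n) :=
  if b then mutpt (lshift n k) (mutate (lshift n k) (frame B 1%:M)) (base_pt k u)
  else base_pt k u.

Definition wpt b B k p u : 'rV[F]_(n + n) :=
  walk (frame B 1%:M) (start_pt b B k u) (map (lshift n) (rev p)).

Lemma base_ptl k u i : base_pt k u 0 (lshift n i) = 1.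
Proof. by rewrite row_mxEl mxE. Qed.

Lemma base_ptr k u i : base_pt k u 0 (rshift n i) = if i == k then u 0 0 else u 0 1.
Proof. by rewrite row_mxEr mxE. Qed.

Lemma base_pt_pos k u : positive u -> positive (base_pt k u).
Proof.
move=> u0 i; case: (split_ordP i) => j ->; first by rewrite base_ptl.
by rewrite base_ptr; case: ifP.
Qed.

Lemma start_pt_pos b B k u : positive u -> positive (start_pt b B k u).
Proof. by move=> u0; case: b; [apply: mutpt_pos|]; apply: base_pt_pos. Qed.

Lemma walk_pos N (E : 'M[int]_N) (v : 'rV[F]_N) w : positive v -> positive (walk E v w).
Proof. by elim: w E v => //= i w IHw E v v0; apply: IHw; apply: mutpt_pos. Qed.

Lemma wpt_pos b B k p u : positive u -> positive (wpt b B k p u).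
Proof. by move=> u0; apply: walk_pos; apply: start_pt_pos. Qed.

Lemma walk_rcons N (E : 'M[int]_N) (v : 'rV[F]_N) (w : seq 'I_N) (i : 'I_N) :
  walk E v (rcons w i) = mutpt i (mutate_seq E w) (walk E v w).
Proof. by elim: w E v => //= j w IHw E v; rewrite IHw. Qed.

Lemma wpt_cons b B k l p u : totally_sign_skew_symmetric B ->
  wpt b B k (l :: p) u = mutpt (lshift n l) (frame (Bw B p) (Cw B p)) (wpt b B k p u).
Proof.
by move=> tB; rewrite /wpt rev_cons map_rcons walk_rcons mutate_seq_frame.
Qed.

Lemma wptr b B k p u i : totally_sign_skew_symmetric B ->
  wpt b B k p u 0 (rshift n i) = if i == k then u 0 0 else u 0 1.
Proof.
move=> tB; elim: p => [|l p IHp].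
  rewrite /wpt /= /start_pt; case: b; rewrite ?mutpt_neq ?base_ptr //.
  by rewrite eq_rlshift.
by rewrite wpt_cons // mutpt_neq ?eq_rlshift.
Qed.

Lemma Laur_wpt b B k p (i : 'I_(n + n)) : totally_sign_skew_symmetric B ->
  Laur (fun u => wpt b B k p u 0 i).
Proof.
move=> tB; have tE := principal_totally_admissible tB.
have Dw : all (@mutable n) (map (lshift n) (rev p)).
  by apply/allP => x /mapP[l _ ->]; apply/mutableP; exists l.
have [E [w [tE' Dw' wE]]] : exists E w, [/\ totally_admissible (@mutable n) E,
    all (@mutable n) w & forall u, wpt b B k p u = walk E (base_pt k u) w].
  case: b; last by exists (frame B 1%:M), (map (lshift n) (rev p)).
  (* The chart at the neighbour amounts to a walk with an extra first step [k], so both charts start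
     from [base_pt]. *)
  exists (mutate (lshift n k) (frame B 1%:M)), (lshift n k :: map (lshift n) (rev p)).
  have Dk : mutable (lshift n k) by apply/mutableP; exists k.
  split=> [w Dw'| |u]; [apply: (tE (_ :: w)) | |]; rewrite /= ?Dk //.
  by rewrite mutateK.
have [] := Laur_comp (M := 2) (g := base_pt k) (Q := fun=> 1) (laurent F i tE' Dw').
- exact: base_pt_pos.
- move=> j; case: (split_ordP j) => m ->.
    by apply: Laur_ext (Laur_const _ 1) => u _; rewrite base_ptl.
  apply: (Laur_ext (fun u _ => base_ptr k u m)).
  by case: eqP => _; apply: Laur_coord.
- exact: Laur_const.
- move=> j; case: (split_ordP j) => m ->.
    by apply: Laur_ext (Laur_const _ 1) => u _; rewrite base_ptl divr1.
  apply: (Laur_ext (fun u _ => congr1 (fun x => 1 / x) (base_ptr k u m))).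
  by case: eqP => _; apply: LaurM (Laur_const _ _) (Laur_coordV _ _).
by move=> m; apply: Laur_ext => u _; rewrite expr1n mulr1 wE.
Qed.

(* As u 0 1 tends to 0, the l-th cluster variable tends to (1 + u 0 0) ^ h l. *)
Definition lead_state b B k p h :=
  forall l, lead (fun u => wpt b B k p u 0 (lshift n l)) (fun u => (1 + u 0 0) ^ h l).

Lemma one_y_gt0 u : positive u -> 0 < 1 + u 0 0.
Proof. by move=> u0; rewrite addr_gt0. Qed.

Lemma lead_state_ge0 b B k p h l : lead_state b B k p h -> 0 <= h l.
Proof. by move=> /(_ l) /lead_ge0. Qed.

Lemma lead_state_ext b B k p h h' : h =1 h' -> lead_state b B k p h -> lead_state b B k p h'.
Proof. by move=> hh H l; rewrite -hh. Qed.

Lemma exch_base B k u : exch (frame B 1%:M) (lshift n k) (base_pt k u) = 1 + u 0 0.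
Proof.
rewrite /exch /mon !big_split_ord /=.
have x1 (a : 'rV[int]_(n + n)) : \prod_i base_pt k u 0 (lshift n i) ^ a 0 (lshift n i) = 1.
  by apply: big1 => i _; rewrite base_ptl exp1rz.
rewrite !x1 !mul1r addrC; congr (_ + _).
  apply: big1 => i _; rewrite [pneg _ _ _ _]mxE block_mxEdl [1%:M _ _]mxE pos_part0 ?expr0z //.
  by case: (i == k).
rewrite (bigD1 k) //= big1 => [|i /negPf ik];
  rewrite base_ptr [ppos _ _ _ _]mxE block_mxEdl [1%:M _ _]mxE.
  by rewrite eqxx mulr1 expr1z.
by rewrite ik expr0z.
Qed.

Lemma lead_state_nil b B k : totally_sign_skew_symmetric B ->
  lead_state b B k [::] (fun l => (b && (l == k))%:R).
Proof.
move=> tB l; rewrite /wpt /= /start_pt; case: b => /=; last first.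
  by apply: lead_ext (lead_const 1) => u _; rewrite ?base_ptl ?expr0z.
case: (eqVneq l k) => [->|lk]; last first.
  apply: lead_ext (lead_const 1) => u _; last by rewrite expr0z.
  by rewrite mutpt_neq ?base_ptl // eq_lshift.
apply: lead_ext (leadD (lead_const 1) (lead_y _)) => u _; last by rewrite expr1z.
by rewrite mutptk exch_mutate exch_base base_ptl divr1.
Qed.

(* The sign e selects one of the two terms of the exchange relation at (M, C). *)
Definition term (e : int) M C l (v : 'rV[F]_(n + n)) : F :=
  (\prod_i v 0 (lshift n i) ^ pos_part (e * M i l)) *
  (\prod_i v 0 (rshift n i) ^ pos_part (e * C i l)).

Lemma exch_term M C l (e : int) v : e = 1 \/ e = -1 ->
  exch (frame M C) (lshift n l) v = term e M C l v + term (- e) M C l v.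
Proof.
suff H : exch (frame M C) (lshift n l) v = term 1 M C l v + term (-1) M C l v.
  by case=> ->; rewrite ?opprK // addrC.
rewrite /exch /mon !big_split_ord /=; congr (_ * _ + _ * _);
  apply: eq_bigr => i _; rewrite 1?[ppos _ _ _ _]mxE 1?[pneg _ _ _ _]mxE;
  by rewrite ?block_mxEul ?block_mxEdl ?mul1r ?mulN1r.
Qed.

Lemma pos_part_ge0 (x : int) : 0 <= pos_part x.
Proof. by rewrite /pos_part le_max lexx orbT. Qed.

Lemma lead_expz f (q : 'rV[F]_2 -> F) (z : int) : 0 <= z -> lead f q ->
  lead (fun u => f u ^ z) (fun u => q u ^ z).
Proof. by case: z => // m _; apply: leadX. Qed.

Lemma lead_vars b B k p h (z : 'I_n -> int) :
    lead_state b B k p h -> (forall i, 0 <= z i) ->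
  lead (fun u => \prod_i wpt b B k p u 0 (lshift n i) ^ z i)
       (fun u => (1 + u 0 0) ^ (\sum_i z i * h i)).
Proof.
move=> H z0.
apply: lead_ext (lead_prod _ (fun i => lead_expz (z0 i) (H i))) => // u u0.
elim/big_rec2: _ => [|i x y _ <-]; first by rewrite expr0z.
by rewrite expfzDr ?(gt_eqF (one_y_gt0 u0)) // exprz_exp [h i * _]mulrC.
Qed.

Lemma lead_coefs b B k p (z : 'I_n -> int) : totally_sign_skew_symmetric B ->
    (forall i, 0 <= z i) ->
  lead (fun u => \prod_i wpt b B k p u 0 (rshift n i) ^ z i)
       (fun u => \prod_i (if i == k then u 0 0 else 0) ^ z i).
Proof.
move=> tB z0; apply: lead_prod => i; apply: lead_expz => //.
apply: (lead_ext (fun u _ => wptr b k p u i tB) (fun _ _ => erefl)).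
by case: eqP => _; [exact: lead_y | exact: lead_eps].
Qed.

Lemma lead_term b B k p h e M C l : totally_sign_skew_symmetric B -> lead_state b B k p h ->
  lead (fun u => term e M C l (wpt b B k p u))
       (fun u => (1 + u 0 0) ^ (\sum_i pos_part (e * M i l) * h i) *
                 \prod_i (if i == k then u 0 0 else 0) ^ pos_part (e * C i l)).
Proof.
move=> tB H; apply: leadM; first by apply: lead_vars => // i; apply: pos_part_ge0.
by apply: lead_coefs => // i; apply: pos_part_ge0.
Qed.

(** The limit of the exchange relation is divided by the limit of the old variable; the Laurent
    phenomenon for the new variable is what [lead_div] needs. *)
Lemma lead_state_cons b B k p h h' l e q : totally_sign_skew_symmetric B ->
    e = 1 \/ e = -1 -> lead_state b B k p h ->
    lead (fun u => term e (Bw B p) (Cw B p) l (wpt b B k p u) +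
                   term (- e) (Bw B p) (Cw B p) l (wpt b B k p u)) q ->
    (forall u, positive u -> q u = (1 + u 0 0) ^ (h l + h' l)) ->
    (forall j, j != l -> h' j = h j) ->
  lead_state b B k (l :: p) h'.
Proof.
move=> tB he H Hq qE h'E j; case: (eqVneq j l) => [->|jl]; last first.
  apply: lead_ext (H j) => u _; last by rewrite h'E.
  by rewrite wpt_cons // mutpt_neq // eq_lshift.
pose x u := wpt b B k p u 0 (lshift n l).
have xn0 u : positive u -> x u != 0 by move=> u0; rewrite gt_eqF //; apply: wpt_pos.
have yn0 u : positive u -> 1 + u 0 0 != 0 by move=> u0; rewrite gt_eqF ?one_y_gt0.
apply: (lead_ext (fun _ _ => erefl) (q := fun u => q u / (1 + u 0 0) ^ h l)) => [u u0|].
  by rewrite qE // expfzDr ?yn0 // mulrC mulKf // expfz_neq0 // yn0.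
apply: (lead_div (H l)).
- by move=> u u0; rewrite expfz_neq0 // yn0.
- apply: lead_ext Hq => // u u0; rewrite wpt_cons // mutptk (exch_term _ _ _ _ he).
  by rewrite -/(x u) mulrC divfK // xn0.
- exact: Laur_wpt.
Qed.

(** The nonzero entry in row [i0] puts a positive power of [u 0 1] into the term of sign [e], which
    dies in the limit. The other term contains no coefficients. *)
Lemma lead_state_monomial b B k p h l e i0 : totally_sign_skew_symmetric B ->
    e = 1 \/ e = -1 -> (forall i, 0 <= e * Cw B p i l) ->
    i0 != k -> Cw B p i0 l != 0 -> lead_state b B k p h ->
  lead_state b B k (l :: p) (fun j => if j == l then
     - h l + \sum_i pos_part (- e * Bw B p i l) * h i else h j).
Proof.
move=> tB he Ce ik Ci H.
apply: (lead_state_cons tB he H (leadD (lead_term _ _ _ _ tB H) (lead_term _ _ _ _ tB H))).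
  move=> u u0; rewrite eqxx addrA subrr add0r.
  rewrite [X in _ * X + _](bigD1 i0) //= (negPf ik) [0 ^ _]exp0rz gt_eqF; last first.
    by rewrite /pos_part lt_max lt_neqAle Ce andbT eq_sym mulf_neq0 //; case: he => ->.
  rewrite mul0r mulr0 add0r [X in _ * X]big1 ?mulr1 // => i _.
  by rewrite pos_part0 ?expr0z // mulNr oppr_le0.
by move=> j /negPf->.
Qed.

(** Both terms survive: their coefficient parts are 1 and [y]. Their cluster parts tend to 1, as the
    only possibly nonzero exponent belongs to [l] and the diagonal of the exchange matrix is
    zero. *)
Lemma lead_state_event b B k p h l e : totally_sign_skew_symmetric B ->
    e = 1 \/ e = -1 -> (forall i, Cw B p i l = if i == k then e else 0) ->
    (forall j, j != l -> h j = 0) -> lead_state b B k p h ->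
  lead_state b B k (l :: p) (fun j => if j == l then 1 - h l else h j).
Proof.
move=> tB he Ce h0 H.
have s0 e' : \sum_i pos_part (e' * Bw B p i l) * h i = 0.
  apply: big1 => i _; case: (eqVneq i l) => [->|il]; last by rewrite h0 ?mulr0.
  by rewrite (tsss_diag l (Bw_tsss p tB)) mulr0 pos_part0 ?mul0r.
have pE e' u : \prod_i (if i == k then u 0 0 else 0) ^ pos_part (e' * Cw B p i l) =
    u 0 0 ^ pos_part (e' * e).
  rewrite (bigD1 k) //= Ce eqxx big1 ?mulr1 // => i /negPf ik.
  by rewrite Ce ik mulr0 pos_part0.
apply: (lead_state_cons tB he H (leadD (lead_term _ _ _ _ tB H) (lead_term _ _ _ _ tB H))).
  have ee : e * e = 1 by case: he => ->.
  move=> u u0; rewrite eqxx (_ : h l + (1 - h l) = 1); last by ring.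
  by rewrite !s0 !pE expr0z !mul1r mulNr ee expr1z addrC.
by move=> j /negPf->.
Qed.

End Degeneration.

(** * Signs of the C- and G-matrices *)

Section Signs.
Variable n : nat.
Implicit Types (v : 'I_n -> int) (C : 'M[int]_n) (e : int) (i j k l : 'I_n).

Definition coh v e := [/\ e = 1 \/ e = -1, forall i, 0 <= e * v i & exists i, v i != 0].

Lemma coh_sign v e : coh v e -> vec_sign v = e.
Proof.
case=> he ve [i0 vi0]; rewrite /vec_sign.
have gt0 : 0 < e * v i0 by rewrite lt_neqAle ve eq_sym mulf_neq0 //; case: he => ->.
case: he => he; rewrite he in ve gt0 *.
  have -> : [forall i, 0 <= v i] by apply/forallP => i; rewrite -[v i]mul1r.
  by have -> : [exists i, 0 < v i] by apply/existsP; exists i0; rewrite -[v i0]mul1r.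
have v0 : forall i, v i <= 0 by move=> i; rewrite -oppr_ge0 -mulN1r.
have -> : [exists i, 0 < v i] = false by apply/existsP => -[i]; rewrite ltNge v0.
have -> : [forall i, v i <= 0] by apply/forallP.
by have -> : [exists i, v i < 0] by apply/existsP; exists i0; rewrite -oppr_gt0 -mulN1r.
Qed.

Lemma sign_coh v : vec_sign v != 0 -> coh v (vec_sign v).
Proof.
rewrite /vec_sign; case: ifP => [/andP[/existsP[i vi] /forallP v0] _|_].
  split; [by left | by move=> j; rewrite mul1r v0 | by exists i; rewrite gt_eqF].
case: ifP => [/andP[/existsP[i vi] /forallP v0] _|_]; last by rewrite eqxx.
split; [by right | | by exists i; rewrite lt_eqF].
by move=> j; rewrite mulN1r oppr_ge0 v0.
Qed.

Lemma coh_coherent v e : coh v e -> sign_coherent v.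
Proof.
case=> -[] -> ve _; [left | right] => i; first by have := ve i; rewrite mul1r.
by have := ve i; rewrite mulN1r oppr_ge0.
Qed.

Lemma coh_uniq v w e e' i : coh v e -> coh w e' -> v i = w i -> v i != 0 -> e = e'.
Proof.
move=> [he ve _] [he' we _] vw vi; have := ve i; have := we i; rewrite -vw.
by case: he he' => -> [] -> //; rewrite mul1r mulN1r oppr_ge0 => h1 h2;
   move: vi; rewrite eq_le h1 h2.
Qed.

Definition unit_col C l k e := forall i, C i l = if i == k then e else 0.

Definition pm_col C l k : bool :=
  [forall i, C i l == (if i == k then 1 else 0)] || [forall i, C i l == (if i == k then -1 else 0)].

Lemma pm_colP C l k :
  reflect (exists2 e, e = 1 \/ e = -1 & unit_col C l k e) (pm_col C l k).
Proof.
apply: (iffP orP) => [[/forallP h|/forallP h]|[e [] -> h]].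
- by exists 1; [left | move=> i; apply/eqP].
- by exists (-1); [right | move=> i; apply/eqP].
- by left; apply/forallP => i; apply/eqP.
- by right; apply/forallP => i; apply/eqP.
Qed.

Lemma col_pm_unitP C l k : col_pm_unit C l k <-> pm_col C l k.
Proof.
have dE (D : 'cV[int]_n) e : D = e *: delta_mx k 0 <-> forall i, D i 0 = if i == k then e else 0.
  split=> [-> i|h]; first by rewrite !mxE andbT; case: eqP => _; rewrite ?mulr1 ?mulr0.
  by apply/colP => i; rewrite h !mxE andbT; case: eqP => _; rewrite ?mulr1 ?mulr0.
have cE e : col l C = e *: delta_mx k 0 <-> unit_col C l k e.
  by rewrite dE; split=> h i; have := h i; rewrite mxE.
rewrite /col_pm_unit -{1}[delta_mx k 0]scale1r -scaleN1r !cE; split.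
  by case=> h; apply/pm_colP; [exists 1; [left|] | exists (-1); [right|]].
by case/pm_colP=> e [] ->; [left | right].
Qed.

Lemma row_pm_unitP C l k : row_pm_unit C l k <-> pm_col C^T l k.
Proof.
rewrite -col_pm_unitP /row_pm_unit /col_pm_unit -tr_row.
have trE (D : 'rV[int]_n) E : D = E <-> D^T = E^T by split=> [->//|]; apply: trmx_inj.
by rewrite (trE _ (delta_mx 0 k)) (trE _ (- delta_mx 0 k)) linearN /= trmx_delta.
Qed.

End Signs.

(** * Signs, duality and the induction on the length of the walk *)

Section SignInduction.
Variable n : nat.
Implicit Types (B M C X : 'M[int]_n) (p : seq 'I_n) (k l i j : 'I_n) (e : int).

Notation tsss := totally_sign_skew_symmetric.

Definition ntr B : 'M[int]_n := - B^T.

Lemma ntrK B : ntr (ntr B) = B.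
Proof. by rewrite /ntr linearN /= opprK trmxK. Qed.

Lemma Bw_tr B p : Bw B^T p = (Bw B p)^T.
Proof. by elim: p => //= k p ->; rewrite mutate_tr. Qed.

Lemma Bw_ntr B p : Bw (ntr B) p = ntr (Bw B p).
Proof.
rewrite /ntr -Bw_tr; elim: p => //= k p ->; exact: mutateN.
Qed.

Lemma Bw_rcons B p k : Bw B (rcons p k) = Bw (mutate k B) p.
Proof. by rewrite /Bw foldr_rcons. Qed.

Lemma Bw_rev B p : Bw (Bw B p) (rev p) = B.
Proof. by elim: p => //= k p IHp; rewrite rev_cons Bw_rcons mutateK. Qed.

Lemma sss_tr B : sign_skew_symmetric B -> sign_skew_symmetric B^T.
Proof. by move=> sB i j; rewrite !mxE; have [h1 h2] := sB j i. Qed.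

Lemma sss_opp B : sign_skew_symmetric B -> sign_skew_symmetric (- B).
Proof.
move=> sB i j; rewrite !mxE mulrNN; have [h1 h2] := sB i j; split=> // /h2[-> ->].
by rewrite oppr0.
Qed.

Lemma tsss_tr B : tsss B -> tsss B^T.
Proof.
by move=> tB s; rewrite -[s]revK mutate_seq_rev Bw_tr -mutate_seq_rev; apply: sss_tr.
Qed.

Lemma tsss_ntr B : tsss B -> tsss (ntr B).
Proof.
move=> tB s; rewrite -[s]revK mutate_seq_rev Bw_ntr -mutate_seq_rev.
by apply: sss_opp; apply: sss_tr.
Qed.

Definition good B p := [/\ forall l, eps_col l (Cw B p) != 0,
  forall l, eps_col l (Cw B p) = eps_col l (Cw (ntr B) p) &
  forall l k, pm_col (Cw B p) l k = pm_col (Cw (ntr B) p) l k].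

(** Only proper suffixes of [p] are covered: [good] holds before each step of the walk, with nothing
    said about its end. *)
Fixpoint tgood B p : Prop := if p is _ :: p' then good B p' /\ tgood B p' else True.

Lemma good_ntr B p : good B p -> good (ntr B) p.
Proof.
by case=> h1 h2 h3; split=> [l|l|l k]; rewrite ?ntrK ?h2 ?h3 // -h2.
Qed.

Lemma tgood_ntr B p : tgood B p -> tgood (ntr B) p.
Proof. by elim: p => //= l p IHp [g /IHp tg]; split=> //; apply: good_ntr. Qed.

Lemma good_coh B p l : good B p -> coh (fun i => Cw B p i l) (eps_col l (Cw B p)).
Proof. by case=> h _ _; apply: sign_coh (h l). Qed.

Lemma Cw_cons B p l : tsss B -> good B p ->
  Cw B (l :: p) = Cw B p *m row_el l (eps_col l (Cw B p)) (Bw B p).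
Proof.
move=> tB g; have [he ge _] := good_coh l g.
by apply: C_step_sign => //; apply: tsss_diag; apply: Bw_tsss.
Qed.

Lemma Gw_cons_Bw B p l : tsss B -> good B p -> Gw B p *m Bw B p = B *m Cw B p ->
  Gw B (l :: p) = Gw B p *m col_el l (- eps_col l (Cw B p)) (Bw B p).
Proof. by move=> tB g GB; have [he ge _] := good_coh l g; apply: G_step_sign. Qed.

Lemma Gw_Bw B p : tsss B -> tgood B p -> Gw B p *m Bw B p = B *m Cw B p.
Proof.
move=> tB; elim: p => [_|l p IHp [g tg]]; first by rewrite /Gw /Cw /= mul1mx mulmx1.
have IH := IHp tg; have [he _ _] := good_coh l g.
have Mll : Bw B p l l = 0 by apply: tsss_diag; apply: Bw_tsss.
rewrite Cw_cons // Gw_cons_Bw //= (mutate_el Mll he) !mulmxA.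
by rewrite -[_ *m col_el _ _ _ *m col_el _ _ _]mulmxA col_elK // mulmx1 IH.
Qed.

Lemma Gw_cons B p l : tsss B -> tgood B (l :: p) ->
  Gw B (l :: p) = Gw B p *m col_el l (- eps_col l (Cw B p)) (Bw B p).
Proof. by move=> tB [g tg]; apply: Gw_cons_Bw => //; apply: Gw_Bw. Qed.

Lemma row_el_ntr l e M : row_el l e (ntr M) = (col_el l (- e) M)^T.
Proof. by rewrite col_elT /row_el /ntr scalerN scaleNr. Qed.

(** Since C and C~ have equal signs, each step multiplies the product on both sides by the same
    involution. *)
Lemma GtC B p : tsss B -> tgood B p -> (Gw B p)^T *m Cw (ntr B) p = 1%:M.
Proof.
move=> tB; elim: p => [_|l p IHp tg]; first by rewrite /Gw /Cw /= trmx1 mulmx1.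
have [g tg'] := tg; have Mll : Bw B p l l = 0 by apply: tsss_diag; apply: Bw_tsss.
rewrite Gw_cons // Cw_cons; [|exact: tsss_ntr|exact: good_ntr].
have [_ <- _] := g; rewrite Bw_ntr row_el_ntr trmx_mul !mulmxA.
rewrite -[_^T *m (Gw B p)^T *m _]mulmxA IHp // mulmx1 -trmx_mul col_elK //.
by rewrite trmx1.
Qed.

Lemma CtG B p : tsss B -> tgood B p -> Cw B p *m (Gw (ntr B) p)^T = 1%:M.
Proof.
move=> tB tg; apply: mulmx1C; rewrite -{2}[B]ntrK; apply: GtC; first exact: tsss_ntr.
exact: tgood_ntr.
Qed.

Lemma int_mulr_eq1 (x y : int) : x * y = 1 -> y = 1 \/ y = -1.
Proof.
move=> xy; have := congr1 absz xy; rewrite abszM => /eqP; rewrite muln_eq1 => /andP[_ /eqP].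
by lia.
Qed.

(** C is invertible over the integers, so a column supported in row [k] alone has an entry 1 or -1
    there. *)
Lemma not_pm_col B p l k : tsss B -> tgood B p -> ~~ pm_col (Cw B p) l k ->
  exists2 i0, i0 != k & Cw B p i0 l != 0.
Proof.
move=> tB tg; case: (boolP [exists i0, (i0 != k) && (Cw B p i0 l != 0)]).
  by move=> /existsP[i /andP[ik Ci]] _; exists i.
rewrite negb_exists => /forallP h /negP[].
have C0 i : i != k -> Cw B p i l = 0.
  by move=> ik; have := h i; rewrite ik negbK => /eqP.
apply/pm_colP; exists (Cw B p k l); last by move=> i; case: eqP => [->//|/eqP]; apply: C0.
have := mulmx1C (CtG tB tg) => /(congr1 (fun A : 'M_n => A l l)); rewrite !mxE eqxx.
rewrite (bigD1 k) //= big1 ?addr0 => [|i ik]; last by rewrite C0 ?mulr0.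
by rewrite mxE => /int_mulr_eq1.
Qed.

Lemma unit_col_eps B p l k e : e = 1 \/ e = -1 -> unit_col (Cw B p) l k e ->
  eps_col l (Cw B p) = e.
Proof.
move=> he u; apply: coh_sign; split=> // [i|]; last first.
  by exists k; rewrite u eqxx; case: he => ->.
by rewrite u; case: eqP => _; rewrite ?mulr0 // -expr2 sqr_ge0.
Qed.

Lemma dual_unit_col B p l k e : tsss B -> tgood B p -> e = 1 \/ e = -1 ->
  unit_col (Cw (ntr B) p) l k e -> forall j, Gw B p k j = if j == l then e else 0.
Proof.
move=> tB tg he u j; have := GtC tB tg => /(congr1 (fun A : 'M_n => A j l)); rewrite !mxE.
rewrite (bigD1 k) //= big1 ?addr0 => [|i ik]; last by rewrite u (negPf ik) mulr0.
rewrite mxE u eqxx => GE; have ee : e * e = 1 by case: he => ->.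
rewrite -[LHS]mulr1 -ee mulrA GE; case: eqP => _; by rewrite ?mul1r ?mul0r.
Qed.

Lemma event_row B p l k e : tsss B -> tgood B p -> good B p -> e = 1 \/ e = -1 ->
  unit_col (Cw B p) l k e -> forall j, Gw B p k j = if j == l then e else 0.
Proof.
move=> tB tg [_ g2 g3] he u; apply: dual_unit_col => //.
have: pm_col (Cw B p) l k by apply/pm_colP; exists e.
rewrite g3 => /pm_colP[e' he' u'].
by rewrite -(unit_col_eps he u) g2 (unit_col_eps he' u').
Qed.

(* true exactly when the k-th row of the G-matrix is nonpositive. *)
Fixpoint row_state B k p : bool :=
  if p is l :: p' then row_state B k p' (+) pm_col (Cw B p') l k else false.

(** Predicted exponents of the limits in chart [b], when [s] tells that row [k] of [G] is
    nonpositive: zero if [b = s], the row up to sign otherwise. *)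
Definition lead_exp (b s : bool) (G : 'M[int]_n) k l : int :=
  if b then (if s then 0 else G k l) else (if s then - G k l else 0).

Lemma lead_exp_linear b s (G : 'M[int]_n) k l M e :
  lead_exp b s (G *m col_el l e M) k l =
  - lead_exp b s G k l + \sum_i pos_part (e * M i l) * lead_exp b s G k i.
Proof.
rewrite /lead_exp mulr_col_el eqxx; case: b; case: s.
- by rewrite oppr0 add0r big1 // => i _; rewrite mulr0.
- by congr (_ + _); apply: eq_bigr => i _; rewrite mulrC.
- rewrite opprD; congr (_ + _); rewrite -sumrN; apply: eq_bigr => i _.
  by rewrite mulrN mulrC.
- by rewrite oppr0 add0r big1 // => i _; rewrite mulr0.
Qed.

(** Away from columns of the form +-e_k the exponents obey the same linear recursion as row [k] of
    G. At such a column the row is a unit vector up to sign, and the rule [1 - h l] exchanges the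
    roles of the two charts. *)
Lemma lead_state_word b B k p : tsss B -> tgood B p ->
  lead_state rat b B k p (lead_exp b (row_state B k p) (Gw B p) k).
Proof.
move=> tB; elim: p b => [|l p IHp] b tg.
  apply: lead_state_ext (lead_state_nil rat b k tB) => l.
  by rewrite /lead_exp /= /Gw /= mxE eq_sym; case: b.
have [g tg'] := tg; have H := IHp b tg'; rewrite Gw_cons //=.
have [he ge _] := good_coh l g; set e := eps_col l _ in he ge *.
set s := row_state B k p in H *.
have Mll : Bw B p l l = 0 by apply: tsss_diag; apply: Bw_tsss.
case: (boolP (pm_col _ _ _)) => [/pm_colP[d hd u]|npm]; last first.
  have [i0 i0k Ci0] := not_pm_col tB tg' npm.
  apply: lead_state_ext (lead_state_monomial tB he ge i0k Ci0 H) => j.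
  rewrite addbF; case: eqP => [->|/eqP/negPf jl]; first by rewrite lead_exp_linear.
  by rewrite /lead_exp mulr_col_el jl.
have Gk := event_row tB tg' g hd u.
(* In the chart [~~ s] the exponent of variable [l] is [d] up to the sign recorded by [s]; it is
   nonnegative, which determines [d]. *)
have sd : d = if s then -1 else 1.
  have := lead_state_ge0 l (IHp (~~ s) tg'); rewrite /lead_exp Gk eqxx -/s.
  by case: (s); case: hd => ->.
have h0 j : j != l -> lead_exp b s (Gw B p) k j = 0.
  by move=> /negPf jl; rewrite /lead_exp Gk jl; case: b {H}; case: (s); rewrite ?oppr0.
apply: lead_state_ext (lead_state_event tB hd u h0 H) => j.
rewrite addbT; case: eqP => [->|/eqP jl]; last first.
  rewrite h0 // /lead_exp mulr_col_el (negPf jl) Gk (negPf jl).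
  by case: b {H h0}; case: (s); rewrite ?oppr0.
rewrite /lead_exp mulr_col_el eqxx big1 ?addr0 => [|i _]; last first.
  by rewrite Gk; case: eqP => [->|_]; rewrite ?mul0r // Mll !mulr0.
by rewrite Gk eqxx sd; case: b {H h0}; case: (s).
Qed.

Definition row_sgn B k p : int := if row_state B k p then -1 else 1.

Lemma row_coh B k p : tsss B -> tgood B p -> coh (Gw B p k) (row_sgn B k p).
Proof.
move=> tB tg; split=> [|l|].
- by rewrite /row_sgn; case: row_state; [right | left].
- have := lead_state_ge0 l (lead_state_word (~~ row_state B k p) k tB tg).
  by rewrite /lead_exp /row_sgn; case: row_state => /=; rewrite ?mulN1r ?mul1r.
have := mulmx1C (GtC tB tg) => /(congr1 (fun A : 'M_n => A k k)); rewrite !mxE eqxx => C1.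
apply/existsP; apply: contraPT C1; rewrite negb_exists => /forallP G0.
rewrite big1 // => i _; have := G0 i; rewrite negbK mxE => /eqP->; exact: mulr0.
Qed.

Lemma row_state_ntr B k p : tgood B p -> row_state (ntr B) k p = row_state B k p.
Proof. by elim: p => //= l p IHp [[_ _ g] /IHp->]; rewrite g. Qed.

Lemma row_el_mutate k e B : row_el k (- e) (mutate k B) = row_el k e B.
Proof.
apply/matrixP => i j; rewrite !mxE; case: eqP => [->|//].
by rewrite /= mulrNN.
Qed.

Lemma col_el_mutate k e B : col_el k (- e) (mutate k B) = col_el k e B.
Proof. by apply: trmx_inj; rewrite !col_elT -mutate_tr row_el_mutate. Qed.

Lemma row_elN k e X : X k k = 0 ->
  row_el k e X *m row_el k (- e) X = 1%:M + e *: only_row k X.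
Proof.
move=> Xk; apply/matrixP => i j; rewrite mulr_row_el.
rewrite !row_elE !mxE eqxx Xk mulr0 // addr0.
case: (eqVneq i k) => [->|ik]; case: (eqVneq j k) => [->|jk];
  rewrite ?eqxx ?Xk ?mulr0 ?oppr0 ?(negPf ik) ?mul0r ?addr0 //=.
by rewrite !add0r mulN1r mulNr pos_partB.
Qed.

Lemma col_elN k e X : X k k = 0 ->
  col_el k (- e) X *m col_el k e X = 1%:M + e *: only_col k X.
Proof.
move=> Xk; apply: trmx_inj; rewrite trmx_mul !col_elT row_elN ?mxE //.
rewrite linearD /= trmx1 linearZ /=; congr (_ + _ *: _).
by apply: trmx_inj; rewrite only_rowT !trmxK.
Qed.

(** Used when the sign of the left factor and that of the right factor flip together: [P'] and [Q']
    carry the old sign, [P] and [Q] the new one. *)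
Lemma mulmx_swap (P P' Q Q' A : 'M[int]_n) : P *m P = 1%:M -> Q' *m Q' = 1%:M ->
  P *m P' *m A = A *m (Q *m Q') -> P' *m A *m Q' = P *m (A *m Q).
Proof.
move=> PP QQ h; have -> : P' *m A = P *m (P *m P' *m A) by rewrite !mulmxA PP mul1mx.
by rewrite h -!mulmxA QQ mulmx1.
Qed.

Lemma event_sgn B k p l e : tsss B -> tgood B p -> good B p -> e = 1 \/ e = -1 ->
  unit_col (Cw B p) l k e -> row_sgn B k p = e.
Proof.
move=> tB tg g he u; have [hs ge _] := row_coh k tB tg.
have := ge l; rewrite (event_row tB tg g he u) eqxx.
by case: hs he => -> [] ->.
Qed.

Lemma base_change B k p : tsss B -> tgood (mutate k B) p -> tgood B (rcons p k) ->
  Cw B (rcons p k) = row_el k (- row_sgn (mutate k B) k p) (mutate k B) *m Cw (mutate k B) p /\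
  Gw B (rcons p k) = col_el k (row_sgn (mutate k B) k p) (mutate k B) *m Gw (mutate k B) p.
Proof.
move=> tB; have tB1 : tsss (mutate k B) by apply: (Bw_tsss [:: k] tB).
have B1k := tsss_diag k tB1.
elim: p => [_ tg|l p IHp tg1 tg0].
  have e1 : eps_col k (Cw B [::]) = 1.
    by apply: (unit_col_eps (k := k)); [left | move=> i; rewrite /Cw /= mxE; case: eqP].
  have [g _] := tg; rewrite Cw_cons // Gw_cons // e1 /Cw /Gw /= !mulmx1 !mul1mx.
  by rewrite -(col_el_mutate k (-1)) -(row_el_mutate k 1) opprK.
have [g1 tg1'] := tg1; have [g0 tg0'] := tg0; have [IHC IHG] := IHp tg1' tg0'.
rewrite !rcons_cons !Gw_cons // !Cw_cons // Bw_rcons.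
set B1 := mutate k B in tB1 B1k IHC IHG g1 tg1 tg1' *; set M := Bw B1 p.
set C1 := Cw B1 p in IHC *; set G1 := Gw B1 p in IHG *.
rewrite (_ : row_sgn B1 k (l :: p) = if row_state B1 k p (+) pm_col C1 l k then -1 else 1) //.
have Ml : M l l = 0 by apply: tsss_diag; apply: Bw_tsss.
have GM : G1 *m M = B1 *m C1 by apply: Gw_Bw.
case: (boolP (pm_col _ _ _)) => [/pm_colP[d hd u]|npm]; last first.
  (* The left factor changes row [k] only, so an entry outside it gives the mutated columns of both
     C-matrices the same sign. *)
  have [i0 i0k Ci0] := not_pm_col tB1 tg1' npm.
  have -> : eps_col l (Cw B (rcons p k)) = eps_col l C1.
    apply: (coh_uniq (good_coh l g0) (good_coh l g1) (i := i0)).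
      by rewrite IHC mul_row_el (negPf i0k).
    by rewrite IHC mul_row_el (negPf i0k).
  by rewrite addbF -/(row_sgn B1 k p) IHC IHG !mulmxA.
have sd := event_sgn tB1 tg1' g1 hd u; have e1 := unit_col_eps hd u; rewrite -/C1 in e1.
have Gk := event_row tB1 tg1' g1 hd u; rewrite -/G1 in Gk.
have hNd : - d = 1 \/ - d = -1 by case: hd => ->; [right | left].
(* The left factor negates the only nonzero entry of this column and adds nothing to it, because
   [B1 k k = 0]. *)
have e0 : eps_col l (Cw B (rcons p k)) = - d.
  apply: (unit_col_eps (k := k)) => // i; rewrite IHC mul_row_el.
  case: (eqVneq i k) => [_|/negPf ik]; last by rewrite u ik.
  rewrite big1 ?addr0 => [|m _]; first by rewrite u eqxx.
  by rewrite u; case: eqP => [->|_]; rewrite ?mulr0 // B1k mulr0 mul0r.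
have -> : (if row_state B1 k p (+) true then -1 else 1) = - d.
  by rewrite -sd /row_sgn addbT; case: row_state.
have dd : d * d = 1 by case: hd => ->.
(* The remaining identities concern row [k] only for C and column [l] only for G. They follow from
   [G1 *m M = B1 *m C1], since row [k] of [G1] and column [l] of [C1] are [d] times unit vectors. *)
rewrite e0 e1 IHC IHG sd !opprK; split; apply: mulmx_swap; rewrite ?row_elK ?col_elK //.
  rewrite !row_elN // mulmxDl mul1mx mulmxDr mulmx1; congr (_ + _).
  rewrite -scalemxAl -scalemxAr; congr (_ *: _); apply/matrixP => i j.
  rewrite mul_only_row [RHS]mxE (bigD1 l) //= [X in _ * X]mxE eqxx big1 ?addr0.
    rewrite u; case: eqP => [->|_]; last by rewrite mul0r.
    rewrite -GM mxE (bigD1 l) //= Gk eqxx big1 ?addr0 // => m /negPf ml.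
    by rewrite Gk ml mul0r.
  by move=> m /negPf ml; rewrite [X in _ * X]mxE ml mulr0.
rewrite !col_elN // mulmxDl mul1mx mulmxDr mulmx1; congr (_ + _).
rewrite -scalemxAl -scalemxAr; congr (_ *: _); apply/matrixP => i j.
rewrite mul_only_col Gk [RHS]mxE; case: eqP => [->|/eqP/negPf jl]; last first.
  by rewrite mulr0 big1 // => m _; rewrite [X in _ * X]mxE jl mulr0.
have <- : (B1 *m C1) i l = B1 i k * d.
  rewrite mxE (bigD1 k) //= u eqxx big1 ?addr0 // => m /negPf mk.
  by rewrite u mk mulr0.
rewrite -GM mxE; apply: eq_bigr => m _; by rewrite [X in _ = _ * X]mxE eqxx.
Qed.

Definition all_good m := forall B p, tsss B -> (size p < m)%N -> good B p.

Lemma all_good_tgood m B p : all_good m -> tsss B -> (size p <= m)%N -> tgood B p.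
Proof.
move=> ag tB; elim: p => //= l p IHp pm; split; last exact: IHp (ltnW pm).
exact: ag.
Qed.

Lemma eps_col_tr k (A : 'M[int]_n) e : coh (A k) e -> eps_col k A^T = e.
Proof.
case=> he ge [i Ai]; apply: coh_sign; split=> // [j|]; first by rewrite mxE.
by exists i; rewrite mxE.
Qed.

(** [base_change] splits the first step of the walk off G as a left factor. Transposed, it is the
    right factor that the last step of the reversed walk contributes to C; the signs agree because
    rows of G become columns of C. *)
Lemma Gw_dual m B p : all_good m -> tsss B -> (size p <= m)%N ->
  (Gw B p)^T = Cw (Bw B p)^T (rev p).
Proof.
move=> ag; elim/last_ind: p B => [|p k IHp] B tB pm; first by rewrite /Gw /Cw /= trmx1.
have tg := all_good_tgood ag tB pm; rewrite size_rcons in pm.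
have tB1 : tsss (mutate k B) by apply: (Bw_tsss [:: k] tB).
have tg1 := all_good_tgood ag tB1 (ltnW pm).
have [_ ->] := base_change tB tg1 tg; rewrite trmx_mul col_elT rev_rcons Bw_rcons.
set B1 := mutate k B in tB1 tg1 *; have IH := IHp B1 tB1 (ltnW pm).
rewrite Cw_cons; last first.
- by apply: ag; rewrite ?size_rev //; apply: tsss_tr; apply: Bw_tsss.
- by apply: tsss_tr; apply: Bw_tsss.
rewrite -IH (eps_col_tr (row_coh k tB1 tg1)); congr (_ *m row_el _ _ _).
by rewrite Bw_tr Bw_rev.
Qed.

Lemma Cw_dual m B p : all_good m -> tsss B -> (size p <= m)%N ->
  Cw B p = (Gw (Bw B p)^T (rev p))^T.
Proof.
move=> ag tB pm; rewrite (Gw_dual ag) ?size_rev //; last by apply: tsss_tr; apply: Bw_tsss.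
by rewrite revK Bw_tr Bw_rev trmxK.
Qed.

(** By duality the columns of [Cw B p] are rows of a G-matrix for the reversed walk, and their
    coherence needs [good] only for shorter words. Passing to [ntr] preserves [row_state], whence
    equal signs. *)
Lemma all_goodS m : all_good m -> all_good m.+1.
Proof.
move=> ag.
have eps B p l : tsss B -> (size p <= m)%N ->
    eps_col l (Cw B p) = row_sgn (Bw B p)^T l (rev p).
  move=> tB pm; rewrite (Cw_dual ag) //; apply: eps_col_tr; apply: row_coh.
    by apply: tsss_tr; apply: Bw_tsss.
  apply: (all_good_tgood ag); rewrite ?size_rev //.
  by apply: tsss_tr; apply: Bw_tsss.
have eps0 B p l : tsss B -> (size p <= m)%N -> eps_col l (Cw B p) != 0.
  by move=> tB pm; rewrite eps // /row_sgn; case: row_state.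
suff pmE B p l k : tsss B -> (size p <= m)%N -> pm_col (Cw (ntr B) p) l k -> pm_col (Cw B p) l k.
  move=> B p tB pm; have tnB := tsss_ntr tB.
  split=> [l|l|l k]; first exact: eps0.
    rewrite !eps // Bw_ntr /row_sgn.
    have -> : (ntr (Bw B p))^T = ntr (Bw B p)^T by rewrite /ntr linearN.
    rewrite row_state_ntr //; apply: (all_good_tgood ag); rewrite ?size_rev //.
    by apply: tsss_tr; apply: Bw_tsss.
  by apply/idP/idP; [rewrite -{1}[B]ntrK|]; apply: pmE.
move=> tB pm /pm_colP[d hd u]; have tg := all_good_tgood ag tB pm.
have Gk := dual_unit_col tB tg hd u; apply/negPn/negP => npm.
have [i0 i0k Ci0] := not_pm_col tB tg npm.
have [he ge _] := sign_coh (eps0 B p l tB pm).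
pose s := row_state B k p; have H := lead_state_word (~~ s) k tB tg.
(* In this chart the exponents form the unit vector at [l], so a monomial step at [l] would give the
   exponent -1. *)
have hl : lead_exp (~~ s) s (Gw B p) k l = 1.
  have := lead_state_ge0 l H; rewrite -/s /lead_exp Gk eqxx.
  by case: (s); case: hd => ->.
have := lead_state_ge0 l (lead_state_monomial tB he ge i0k Ci0 H).
rewrite eqxx -/s hl big1 // => i _; case: (eqVneq i l) => [->|/negPf il].
  by rewrite (tsss_diag l (Bw_tsss p tB)) mulr0 mul0r.
by rewrite /lead_exp Gk il; case: (s); rewrite /= ?oppr0 mulr0.
Qed.

Lemma tsss_good B p : tsss B -> good B p.
Proof.
suff ag m : all_good m by move=> tB; apply: (ag (size p).+1).
by elim: m => [//|m]; apply: all_goodS.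
Qed.

Lemma tsss_tgood B p : tsss B -> tgood B p.
Proof. by move=> tB; elim: p => //= l p IHp; split=> //; apply: tsss_good. Qed.

End SignInduction.

(** * C- and G-matrices on the tree *)

Section Vertices.
Variable n : nat.
Implicit Types (M : vertex n -> 'M[int]_n) (t : vertex n) (p w : seq 'I_n) (k : 'I_n).

Definition mutation_pattern M := forall k t, M (nbr k t) = mutate k (M t).

Lemma pattern_Bw M t0 p : mutation_pattern M -> M (foldr (@nbr n) t0 p) = Bw (M t0) p.
Proof. by move=> mM; elim: p => //= k p <-; rewrite mM. Qed.

Lemma CG_alongE M t0 p : mutation_pattern M -> CG_along M t0 p = CGw (M t0) p.
Proof.
by move=> mM; elim: p => //= k p ->; rewrite pattern_Bw //; case: CGw.
Qed.

Lemma CmatE M t0 t : mutation_pattern M -> Cmat M t0 t = Cw (M t0) (geodesic t0 t).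
Proof. by move=> mM; rewrite /Cmat CG_alongE. Qed.

Lemma GmatE M t0 t : mutation_pattern M -> Gmat M t0 t = Gw (M t0) (geodesic t0 t).
Proof. by move=> mM; rewrite /Gmat CG_alongE. Qed.

Lemma mutation_pattern_neg_tr M : mutation_pattern M -> mutation_pattern (neg_tr M).
Proof. by move=> mM k t; rewrite /neg_tr mM -mutate_tr mutateN. Qed.

Lemma geodesic_uniq t0 w : reduced w -> geodesic t0 (foldr (@nbr n) t0 w) = w.
Proof.
elim: w => [_|a w IHw] /=; first exact: geodesic_id.
rewrite geodesic_nbr; case: w IHw => [|b w] IHw rw; first by rewrite geodesic_id.
have /andP[ab rw'] : (a != b) && reduced (b :: w) by [].
by rewrite IHw //= eq_sym (negPf ab).
Qed.

Lemma reduced_rcons w a k : reduced (rcons (rcons w a) k) = reduced (rcons w a) && (a != k).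
Proof. by case: w => [|b w]; rewrite /reduced /= ?andbT // !rcons_path last_rcons. Qed.

(** The edge [k] at [t0] either begins the geodesic from [t0] or extends it at its start; the first
    label crossed is the last letter of the word. *)
Lemma geodesic_nbr_l t0 t k :
  geodesic t0 t = rcons (geodesic (nbr k t0) t) k \/
  geodesic (nbr k t0) t = rcons (geodesic t0 t) k.
Proof.
have := geodesic_reduced (nbr k t0) t; have := foldr_nbr_geodesic (nbr k t0) t.
case/lastP: (geodesic _ t) => [|q a] tE rq.
  by left; rewrite -[in LHS]tE -(foldr_rcons _ t0 [::]) geodesic_uniq.
case: (eqVneq a k) => [ak|ak]; last first.
  by left; rewrite -[in LHS]tE -(foldr_rcons _ t0 (rcons q a)) geodesic_uniq // reduced_rcons rq.
right; rewrite ak; congr rcons; rewrite -tE ak foldr_rcons nbrK geodesic_uniq //.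
by move: rq; case/lastP: q {tE} => [//|q b]; rewrite reduced_rcons => /andP[].
Qed.

(** If the geodesic from the neighbour passes through [t0], this is [base_change] based at the
    neighbour. Otherwise [base_change] is based at [t0] and inverted, its elementary factors being
    involutions. *)
Lemma CGmat_nbr M t0 t k : mutation_pattern M -> (forall t, totally_sign_skew_symmetric (M t)) ->
  Cmat M (nbr k t0) t = row_el k (- eps_row k (Gmat M t0 t)) (M t0) *m Cmat M t0 t /\
  Gmat M (nbr k t0) t = col_el k (eps_row k (Gmat M t0 t)) (M t0) *m Gmat M t0 t.
Proof.
move=> mM tM; have tg t' p : tgood (M t') p by apply: tsss_tgood.
have Mkk : M (nbr k t0) k k = 0 by apply: tsss_diag.
rewrite !CmatE // !GmatE // /eps_row; case: (geodesic_nbr_l t0 t k) => ->; last first.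
  rewrite (coh_sign (row_coh k (tM t0) (tg _ _))).
  have mE : mutate k (M (nbr k t0)) = M t0 by rewrite mM mutateK.
  have := @base_change _ (M (nbr k t0)) k (geodesic t0 t) (tM _).
  by rewrite mE; apply.
set p := geodesic _ t; have := base_change (tM t0) _ (tg t0 (rcons p k)).
rewrite -mM => /(_ (tg _ _))[-> ->]; set s := row_sgn _ k p.
have [hs ge [i Gi]] := row_coh k (tM (nbr k t0)) (tg (nbr k t0) p).
(* The left factor just negates row [k], so the sign at [t0] is opposite to the one at the
   neighbour. *)
have GkE j : (col_el k s (M (nbr k t0)) *m Gw (M (nbr k t0)) p) k j = - Gw (M (nbr k t0)) p k j.
  by rewrite mul_col_el eqxx Mkk mulr0 mul0r addr0.
have -> : vec_sign ((col_el k s (M (nbr k t0)) *m Gw (M (nbr k t0)) p) k) = - s.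
  apply: coh_sign; split=> [|j|]; first by rewrite /s; case: hs => ->; [right | left].
    by rewrite GkE mulrNN.
  by exists i; rewrite GkE oppr_eq0.
rewrite opprK -[M t0](mutateK k) -{1}[s]opprK row_el_mutate col_el_mutate -mM.
by rewrite !mulmxA row_elK // col_elK // !mul1mx.
Qed.

End Vertices.

Theorem theorem4p10 (n : nat) (B : vertex n -> 'M[int]_n)
    (hB : exchange_pattern B)
    (hac : exists (t : vertex n) (A : 'M[int]_n),
        [/\ sign_skew_symmetric A, acyclic A & mutation_equivalent (B t) A])
    (t0 : vertex n) :
  let C := Cmat B in
  let G := Gmat B in
  let Ctilde := Cmat (neg_tr B) in
  let Gtilde := Gmat (neg_tr B) in
  [/\ (forall (t : vertex n) (k : 'I_n),
         eps_col k (C t0 t) = eps_col k (Ctilde t0 t)),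
      (forall (t : vertex n) (i j : 'I_n),
         col_pm_unit (C t0 t) i j <-> col_pm_unit (Ctilde t0 t) i j),
      (forall t : vertex n, (G t0 t)^T *m Ctilde t0 t = 1%:M),
      (forall (t1 t : vertex n) (k : 'I_n), edge k t0 t1 ->
         [/\ forall i : 'I_n, sign_coherent (G t0 t i),
             C t1 t = (J_mx k
               + only_row k (pos_mx (- eps_row k (G t0 t) *: B t0))) *m C t0 t
           & G t1 t = (J_mx k
               + only_col k (pos_mx (eps_row k (G t0 t) *: B t0))) *m G t0 t])
    & (forall (t : vertex n) (i j k : 'I_n),
         [/\ sign_coherent (G t0 t k),
             sign_coherent (Gtilde t0 t k),
             eps_row k (G t0 t) = eps_row k (Gtilde t0 t)
           & row_pm_unit (G t0 t) i j <-> row_pm_unit (Gtilde t0 t) i j])].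
Proof.
case: hB => tB mB; have {}mB : mutation_pattern B by move=> k t; apply: mB.
have mN := mutation_pattern_neg_tr mB => C G Ct Gt.
have CE t t' : C t t' = Cw (B t) (geodesic t t') by apply: CmatE.
have GE t t' : G t t' = Gw (B t) (geodesic t t') by apply: GmatE.
have CtE t t' : Ct t t' = Cw (ntr (B t)) (geodesic t t') by apply: CmatE.
have GtE t t' : Gt t t' = Gw (ntr (B t)) (geodesic t t') by apply: GmatE.
have gd t p : good (B t) p by apply: tsss_good.
have tg t p : tgood (B t) p by apply: tsss_tgood.
split.
- by move=> t k; rewrite CE CtE; have [_ -> _] := gd t0 (geodesic t0 t).
- move=> t i j; rewrite CE CtE !col_pm_unitP.
  by have [_ _ ->] := gd t0 (geodesic t0 t).
- by move=> t; rewrite GE CtE GtC.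
- move=> t1 t k ->; have [hC hG] := CGmat_nbr t0 t k mB tB; split=> // i.
  by rewrite GE; apply: coh_coherent (row_coh i (tB t0) (tg t0 _)).
- move=> t i j k; rewrite GE GtE; set p := geodesic t0 t.
  have tN := tsss_ntr (tB t0); have tgN := tsss_tgood p tN.
  have h1 := row_coh k (tB t0) (tg t0 p); have h2 := row_coh k tN tgN.
  split; [exact: coh_coherent h1 | exact: coh_coherent h2 | |].
    by rewrite /eps_row (coh_sign h1) (coh_sign h2) /row_sgn row_state_ntr.
  (* Duality turns rows of G into columns of C for the reversed walk from the transposed matrix,
     where the third clause of [good] compares C with C~. *)
  have ag : all_good n (size p) by move=> B' p' tB' _; apply: tsss_good.
  rewrite !row_pm_unitP !(Gw_dual ag) // Bw_ntr.
  have -> : (ntr (Bw (B t0) p))^T = ntr (Bw (B t0) p)^T by rewrite /ntr linearN.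
  by have [_ _ ->] := tsss_good (rev p) (tsss_tr (Bw_tsss p (tB t0))).
Qed.
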